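(* The problem $1|jrp,p_j=1,r_j|\sum C_j+c_\mathcal{Q}$ (with the number $s$ of resources part of the input) is NP-hard, even if $K_0=0$ and $K_i=1$ for $i=1,\dots,s$.
   Context: Problem $1|jrp,r_j|c_S+c_\mathcal{Q}$: a set $\mathcal{J}$ of $n$ jobs must be processed non-preemptively on a single machine that processes at most one job at a time. Job $j$ has processing time $p_j>0$ and release date $r_j\ge 0$. There are resources $\mathcal{R}=\{R_1,\dots,R_s\}$, and each job $j$ requires a nonempty subset $R(j)\subseteq\mathcal{R}$. There are nonnegative costs $K_0,K_1,\dots,K_s$. A solution is a pair $(S,\mathcal{Q})$, where $S$ assigns a start time $S_j$ to each job (completion time $C_j=S_j+p_j$), and $\mathcal{Q}=\{(\mathcal{R}_1,t_1),\dots,(\mathcal{R}_q,t_q)\}$ with $t_1<\dots<t_q$ and $\mathcal{R}_\ell\subseteq\mathcal{R}$ (the resources in $\mathcal{R}_\ell$ are replenished at time $t_\ell$). Job $j$ is ready to be started at time $t$ if $R(j)\subseteq\bigcup_{\ell:\,t_\ell\in[r_j,t]}\mathcal{R}_\ell$. The solution is feasible if no two jobs overlap and each job $j$ is ready to be started at $S_j$. The replenishment cost is $c_\mathcal{Q}=\sum_{\ell=1}^q(K_0+\sum_{R_i\in\mathcal{R}_\ell}K_i)$. In $1|jrp,p_j=1,r_j|\sum C_j+c_\mathcal{Q}$ all processing times equal $1$ and the goal is to minimize $\sum_jC_j+c_\mathcal{Q}$. *)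

(* Defs.v *)
From HB Require Import structures.
From mathcomp Require Import all_boot all_order all_algebra.

Set Implicit Arguments.
Unset Strict Implicit.
Unset Printing Implicit Defensive.

Import Order.TTheory GRing.Theory Num.Theory.

(** * Deterministic multi-tape Turing machines *)

Inductive move := MoveL | Stay | MoveR.

(* Tape symbols are the blank [None], the bits [Some (inl b)], and finitely many
   machine-specific work symbols [Some (inr g)].  There are [tm_work.+1] tapes,
   of which tape [ord0] carries both the input and the output. *)
Record TM := MkTM {
  tm_work : nat;
  tm_gamma : finType;
  tm_state : finType;
  tm_start : tm_state;
  tm_halt : pred tm_state;
  tm_delta : tm_state ->
    {ffun 'I_tm_work.+1 -> option (bool + tm_gamma)} ->
    tm_state * {ffun 'I_tm_work.+1 -> option (bool + tm_gamma) * move}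
}.

Section Run.
Variable M : TM.

Definition sym : Type := option (bool + tm_gamma M).

(* Two-way infinite tapes: [(l, r)] has [r] from the scanned cell rightwards and
   [l] from the cell left of it leftwards; all cells beyond [l], [r] are blank. *)
Definition tape : Type := (seq sym * seq sym)%type.

Definition tape_read (t : tape) : sym := head None t.2.

Definition tape_act (a : sym * move) (t : tape) : tape :=
  let r := a.1 :: behead t.2 in
  match a.2 with
  | MoveL => (behead t.1, head None t.1 :: r)
  | Stay => (t.1, r)
  | MoveR => (a.1 :: t.1, behead r)
  end.

Definition config : Type :=
  (tm_state M * {ffun 'I_(tm_work M).+1 -> tape})%type.

Definition halted (c : config) : bool := tm_halt c.1.

Definition step (c : config) : config :=
  if halted c then c else
  let d := tm_delta c.1 [ffun i => tape_read (c.2 i)] in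
  (d.1, [ffun i => tape_act (d.2 i) (c.2 i)]).

Definition init (x : seq bool) : config :=
  (tm_start M,
   [ffun i => if i == ord0 then ([::], [seq Some (inl b) | b <- x])
              else ([::], [::])]).

Fixpoint bits_prefix (u : seq sym) : seq bool :=
  if u is Some (inl b) :: u' then b :: bits_prefix u' else [::].

(* The output is the maximal word of bits starting at the head of tape [ord0]. *)
Definition output (c : config) : seq bool := bits_prefix (c.2 ord0).2.

End Run.

(** * Polynomial time, NP, NP-hardness *)

Definition poly_bound (c d n : nat) : nat := c * n ^ d + c.

Definition polytime (f : seq bool -> seq bool) : Prop :=
  exists (M : TM) (c d : nat), forall x : seq bool,
    let C := iter (poly_bound c d (size x)) (@step M) (init M x) in
    halted C /\ output C = f x.

(* Self-delimiting: every bit of [x] is preceded by [true], and [false] ends it. *)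
Definition delimit (x : seq bool) : seq bool :=
  flatten [seq [:: true; b] | b <- x] ++ [:: false].

Definition pair_enc (x w : seq bool) : seq bool := delimit x ++ w.

Definition in_NP (L : seq bool -> Prop) : Prop :=
  exists (v : seq bool -> bool) (c d : nat),
    polytime (fun z => [:: v z]) /\
    forall x, L x <->
      exists2 w, size w <= poly_bound c d (size x) & v (pair_enc x w).

Record decision_problem := DecisionProblem {
  dp_inst : Type;
  dp_enc : dp_inst -> seq bool;
  dp_yes : dp_inst -> Prop
}.

(* NP-hardness (under polynomial-time many-one reductions) of the restriction of
   [P] to the instances satisfying [C]: every value of a reduction is required
   to be (the encoding of) an instance satisfying [C]. *)
Definition NP_hard_on (P : decision_problem) (C : dp_inst P -> Prop) : Prop :=
  forall L : seq bool -> Prop, in_NP L ->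
    exists f : seq bool -> dp_inst P,
      [/\ polytime (fun x => dp_enc (f x)),
          forall x, C (f x) &
          forall x, L x <-> dp_yes (f x)].

(** * Single-machine scheduling with joint replenishment *)

Record jrp := Jrp {
  jobs : nat;
  resources : nat;
  proc : {ffun 'I_jobs -> nat};
  release : {ffun 'I_jobs -> nat};
  req : {ffun 'I_jobs -> {set 'I_resources}};
  K0 : nat;
  K : {ffun 'I_resources -> nat};
  proc_gt0 : [forall j, 0 < proc j];
  req_neq0 : [forall j, req j != set0]
}.

Section Solution.
Local Open Scope ring_scope.
Variables (R : archiRealDomainType) (I : jrp).

(* An element [(A, t)] of [repl] replenishes the resources in [A] at time [t]. *)
Record solution := Solution {
  start : {ffun 'I_(jobs I) -> R};
  repl : seq ({set 'I_(resources I)} * R);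
  repl_sorted : sorted <%R [seq q.2 | q <- repl]
}.

Definition completion (s : solution) (j : 'I_(jobs I)) : R :=
  start s j + (proc I j)%:R.

Definition ready (s : solution) (j : 'I_(jobs I)) (t : R) : bool :=
  req I j \subset \bigcup_(q <- repl s | (release I j)%:R <= q.2 <= t) q.1.

Definition feasible (s : solution) : Prop :=
  (forall j k, j != k ->
     completion s j <= start s k \/ completion s k <= start s j) /\
  (forall j, ready s j (start s j)).

Definition repl_cost (s : solution) : R :=
  \sum_(q <- repl s) (K0 I + \sum_(i in q.1) K I i)%N%:R.

Definition total_cost (s : solution) : R :=
  \sum_j completion s j + repl_cost s.

End Solution.

(** * Binary encoding of instances *)

(* Binary digits, least significant first, without superfluous zeros; [fuel] only
   serves structural recursion and [fuel = n] always suffices. *)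
Fixpoint bin_rec (fuel n : nat) : seq bool :=
  if fuel is fuel'.+1 then
    if n == 0 then [::] else odd n :: bin_rec fuel' n./2
  else [::].

Definition bin (n : nat) : seq bool := bin_rec n n.

Definition enc_nats (s : seq nat) : seq bool :=
  flatten [seq delimit (bin n) | n <- s].

Definition jrp_data (I : jrp) : seq nat :=
  [:: jobs I, resources I, K0 I &
    codom (K I) ++ codom (proc I) ++ codom (release I) ++
    [seq (i \in req I j : nat) | j <- enum 'I_(jobs I),
                                 i <- enum 'I_(resources I)]].

Definition jrp_enc (IB : jrp * nat) : seq bool :=
  enc_nats (IB.2 :: jrp_data IB.1).

(* Decision version of 1|jrp,r_j|sum C_j + c_Q: given an instance and a
   threshold [B], is there a feasible solution of cost at most [B]?  Start and
   replenishment times range over [R]. *)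
Definition jrp_sumC (R : archiRealDomainType) : decision_problem :=
  @DecisionProblem (jrp * nat)%type jrp_enc
    (fun IB => exists s : solution R IB.1,
       feasible s /\ (total_cost s <= (IB.2)%:R)%R).

Definition unit_proc (I : jrp) : Prop := forall j, proc I j = 1.

Definition unit_resource_costs (I : jrp) : Prop :=
  K0 I = 0 /\ forall i, K I i = 1.

(** * The encodings are injective *)

Lemma delimit_cat_inj x y u v :
  delimit x ++ u = delimit y ++ v -> x = y /\ u = v.
Proof.
rewrite /delimit.
elim: x y => [|a x IH] [|b y] //=; first by case.
by case=> -> /IH[-> ->].
Qed.

Lemma pair_enc_inj x y u v : pair_enc x u = pair_enc y v -> x = y /\ u = v.
Proof. exact: delimit_cat_inj. Qed.

Lemma bin_recK fuel n : n <= fuel ->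
  foldr (fun (b : bool) m => b + m.*2) 0 (bin_rec fuel n) = n.
Proof.
elim: fuel n => [|k IH] [|n] // lenk.
have lt_half : n.+1./2 < n.+1 by rewrite -divn2 ltn_Pdiv.
by rewrite [bin_rec _ _]/= -/(n.+1./2) /= IH ?(odd_double_half n.+1) //
           -ltnS (leq_trans lt_half lenk).
Qed.

Lemma bin_inj : injective bin.
Proof.
apply: (can_inj (g := foldr (fun (b : bool) m => b + m.*2) 0)).
by move=> n; exact: bin_recK.
Qed.

Lemma enc_nats_inj : injective enc_nats.
Proof.
rewrite /enc_nats; elim=> [|m s IH] [|n t] //=.
- by rewrite /delimit; case: (bin n).
- by rewrite /delimit; case: (bin m).
by case/delimit_cat_inj => /bin_inj-> /IH->.
Qed.

Lemma codom_ffun_inj (T : finType) (A : eqType) (f g : {ffun T -> A}) :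
  codom f = codom g -> f = g.
Proof.
move=> /eq_in_map fg; apply/ffunP => x; apply: fg.
by rewrite mem_enum.
Qed.

Lemma jrp_enc_inj : injective jrp_enc.
Proof.
move=> [[n s p r q k0 k hp hq] B] [[n' s' p' r' q' k0' k' hp' hq'] B'].
move/enc_nats_inj => [/= -> en es ek0 /eqP]; subst n' s' k0'.
rewrite !eqseq_cat ?size_codom //.
case/and4P => /eqP/codom_ffun_inj ek /eqP/codom_ffun_inj ep.
move=> /eqP/codom_ffun_inj er /eqP eq; subst k' p' r'.
have eqq : q = q'.
  apply/ffunP => j; apply/setP => i.
  move: eq; have := mem_enum 'I_n j; rewrite inE.
  elim: (enum 'I_n) => //= j0 js IH; rewrite inE => jin /eqP.
  rewrite eqseq_cat ?size_map // => /andP[/eqP/eq_in_map e1 /eqP e2].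
  case/predU1P: jin => [->|jin]; last exact: IH.
  have := e1 i; rewrite mem_enum => /(_ isT).
  by case: (i \in q j0); case: (i \in q' j0).
by subst q'; rewrite (bool_irrelevance hp' hp) (bool_irrelevance hq' hq).
Qed.

(* Main.v *)
Require Import Defs.
From mathcomp Require Import all_boot all_order all_algebra.
From mathcomp Require Import zify.
From Stdlib Require Import FunctionalExtensionality.

(** Scheduling as a clique problem.  Let [compat] be a relation on a finite set
    [U].  Take [U] as the set of resources, a job of release date 0 requiring
    [{a, b}] for every compatible pair [(a, b)] (and requiring all of [U] for
    the other pairs), and more than [k] late jobs of release date [k^2] that
    require all of [U].  A schedule without idle time that replenishes all of
    [U] once, at time [k^2], and only [k] resources before has to run [k^2] pair
    jobs before time [k^2], so that the [k] early resources are pairwise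
    compatible; an idle slot before time [k^2] delays every late job and is
    dearer than the [k] resources it may save.

    A nondeterministic computation as a clique.  A node is a time, a position
    relative to the heads, and a tile: the state, the scanned symbols and the
    symbols at that position.  Because each tile carries the scanned symbols,
    the transition rule only relates two tiles at a time, and an accepting
    computation is a clique with one tile per time and position.

    Polynomial time.  The encoding of the instance is printed by nested loops
    whose bounds and tests are arithmetic expressions in the length and the bits
    of the input; such programs run on a counter machine, in which a counter is
    the position of a head, and hence on a multi-tape Turing machine. *)

Set Implicit Arguments.
Unset Strict Implicit.
Unset Printing Implicit Defensive.

Import Order.TTheory GRing.Theory Num.Theory.

(** * Tapes as functions on the integers *)

Section Cells.
Variable M : TM.
Implicit Types (t : tape M) (w : seq (sym M)) (j : int).

(** Positions are relative to the head. Reading beyond the stored lists gives a blank, so tapes that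
    differ only in explicitly stored outer blanks have the same cells. *)
Definition cell t j : sym M :=
  match j with Posz k => nth None t.2 k | Negz k => nth None t.1 k end.

Definition shift (m : move) : int :=
  match m with MoveL => -1 | Stay => 0 | MoveR => 1 end%R.

Lemma tape_readE t : tape_read t = cell t 0.
Proof. by rewrite /tape_read -nth0. Qed.

(** Position [j] seen from the new head is position [j + shift a.2] seen from the old one, and old
    position 0 has been overwritten. *)
Lemma cell_act a t j :
  cell (tape_act a t) j =
  if (j + shift a.2 == 0)%R then a.1 else cell t (j + shift a.2)%R.
Proof.
case: a => s []; case: t => l r; rewrite /tape_act [shift _]/= [fst _]/=.
- case: j => [[|[|k]]|k].
  + by rewrite /= -nth0.
  + by [].
  + have -> : (Posz k.+2 + -1 = Posz k.+1)%R by lia.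
    by rewrite /= nth_behead.
  + have -> : (Negz k + -1 = Negz k.+1)%R by lia.
    by rewrite /= nth_behead.
- rewrite addr0; case: j => [[|k]|k] //=.
  by rewrite nth_behead.
- case: j => [k|[|k]].
  + have -> : (Posz k + 1 = Posz k.+1)%R by lia.
    by rewrite /= nth_behead.
  + by [].
  + have -> : (Negz k.+1 + 1 = Negz k)%R by lia.
    by [].
Qed.

Lemma cell_move t m j : cell (tape_act (tape_read t, m) t) j = cell t (j + shift m)%R.
Proof. by rewrite cell_act /= tape_readE; case: eqP => // ->. Qed.

Definition word_cell w j : sym M := if j is Posz k then nth None w k else None.

(* The tape holds the word [w] on cells 0, 1, ..., is blank elsewhere, and its
   head is on cell [p]. *)
Definition at_pos t w (p : nat) := forall j, cell t j = word_cell w (j + p%:Z)%R.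

Lemma at_pos_read t w p : at_pos t w p -> tape_read t = nth None w p.
Proof. by move=> h; rewrite tape_readE h add0r. Qed.

Lemma at_pos_stay t w p : at_pos t w p -> at_pos (tape_act (tape_read t, Stay) t) w p.
Proof. by move=> h j; rewrite cell_move addr0. Qed.

Lemma at_pos_right t w p :
  at_pos t w p -> at_pos (tape_act (tape_read t, MoveR) t) w p.+1.
Proof. by move=> h j; rewrite cell_move h; congr word_cell; rewrite /=; lia. Qed.

Lemma at_pos_left t w p :
  at_pos t w p.+1 -> at_pos (tape_act (tape_read t, MoveL) t) w p.
Proof. by move=> h j; rewrite cell_move h; congr word_cell; rewrite /=; lia. Qed.

Lemma at_pos_append t w s :
  at_pos t w (size w) -> at_pos (tape_act (s, MoveR) t) (rcons w s) (size w).+1.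
Proof.
move=> h j; rewrite cell_act /= h.
have -> : (j + (size w).+1%:Z = j + 1 + (size w)%:Z)%R by lia.
case: eqP => [->|]; first by rewrite add0r /= nth_rcons ltnn eqxx.
case: (j + 1)%R => [k|k].
  case: k => [|k] // _; rewrite /= nth_rcons.
  have -> : (k.+1 + size w == size w) = false by lia.
  have -> : (k.+1 + size w < size w) = false by lia.
  by rewrite nth_default // leq_addl.
case E : (Negz k + size w)%R => [m|//] _ /=.
by rewrite nth_rcons; have -> : m < size w by lia.
Qed.

(** Erasing the first letter while moving right renumbers the cells: the rest of the word starts
    again at cell 0. *)
Lemma at_pos_erase t s w :
  at_pos t (s :: w) 0 -> at_pos (tape_act (None, MoveR) t) w 0.
Proof.
move=> h j; rewrite cell_act /= h !addr0.
case: j => [k|[|k]] //.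
by have -> : (Posz k + 1 = Posz k.+1)%R by lia.
Qed.

Lemma at_pos_write t s : at_pos t [::] 0 -> at_pos (tape_act (s, Stay) t) [:: s] 0.
Proof.
move=> h j; rewrite cell_act /= h !addr0.
by case: j => [[|k]|k] //=; rewrite nth_nil.
Qed.

Lemma at_pos_init w : at_pos ([::], w) w 0.
Proof. by move=> j; rewrite addr0; case: j => k //=; rewrite nth_nil. Qed.

Definition bits_of (x : seq bool) : seq (sym M) := [seq Some (inl b) | b <- x].

Lemma bits_prefix_at t x : at_pos t (bits_of x) 0 -> bits_prefix t.2 = x.
Proof.
move=> h; have {h} : forall k, nth None t.2 k = nth None (bits_of x) k.
  by move=> k; have := h (Posz k); rewrite addr0.
elim: x t.2 => [|b x IH] [|s r] //= h.
- by have := h 0; rewrite /= => ->.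
- by have := h 0.
- have /= -> := h 0; congr cons; apply: IH => k; exact: (h k.+1).
Qed.

End Cells.

(** * Counter machines *)

Inductive test := IsZero of nat | IsBit.

Inductive cmd :=
| Skip
| Inc of nat
| Dec of nat
| Emit of bool
| Seq of cmd & cmd
| While of nat & cmd
| If of test & cmd & cmd.

Definition regs := nat -> nat.
Definition upd (s : regs) (r v : nat) : regs := fun i => if i == r then v else s i.

(* Register 0 is a cursor on the read-only word [y], counted from 1: when it
   contains [k.+1], [IsBit] reads the bit of index [k]. *)
Definition holds (y : seq bool) (s : regs) (b : test) : bool :=
  match b with
  | IsZero r => s r == 0
  | IsBit => (0 < s 0) && nth false y (s 0).-1
  end.

(** The number counts the steps of the compiled code exactly: a loop round costs a test and a jump
    back, a taken [If] a test and a jump over the other branch, whose end falls through. *)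
Inductive exec (y : seq bool) : cmd -> regs * seq bool -> nat -> regs * seq bool -> Prop :=
| ESkip s : exec y Skip s 0 s
| EInc r s o : exec y (Inc r) (s, o) 1 (upd s r (s r).+1, o)
| EDec r s o : exec y (Dec r) (s, o) 1 (upd s r (s r).-1, o)
| EEmit b s o : exec y (Emit b) (s, o) 1 (s, rcons o b)
| ESeq c1 c2 s1 s2 s3 t1 t2 :
    exec y c1 s1 t1 s2 -> exec y c2 s2 t2 s3 -> exec y (Seq c1 c2) s1 (t1 + t2) s3
| EWhile0 r c s : s.1 r = 0 -> exec y (While r c) s 1 s
| EWhileS r c s1 s2 s3 t1 t2 : s1.1 r != 0 ->
    exec y c s1 t1 s2 -> exec y (While r c) s2 t2 s3 ->
    exec y (While r c) s1 (t1 + t2).+2 s3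
| EIfT b c1 c2 s1 s2 t : holds y s1.1 b -> exec y c1 s1 t s2 ->
    exec y (If b c1 c2) s1 t.+2 s2
| EIfF b c1 c2 s1 s2 t : ~~ holds y s1.1 b -> exec y c2 s1 t s2 ->
    exec y (If b c1 c2) s1 t.+1 s2.

Definition test_reg (b : test) : nat := if b is IsZero r then r else 0.

Fixpoint max_reg (c : cmd) : nat :=
  match c with
  | Skip | Emit _ => 0
  | Inc r | Dec r => r
  | Seq c1 c2 => maxn (max_reg c1) (max_reg c2)
  | While r c => maxn r (max_reg c)
  | If b c1 c2 => maxn (test_reg b) (maxn (max_reg c1) (max_reg c2))
  end.

(** * Compilation of counter programs to Turing machines *)

Section Compile.
Variable W : nat.

Local Notation symb := (option (bool + unit)).
Local Notation reads := {ffun 'I_W.+1 -> symb}.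
Local Notation acts := {ffun 'I_W.+1 -> symb * move}.

(* An instruction maps the scanned symbols to the action and the next address. *)
Definition instr := reads -> acts * nat.

Definition mark : symb := Some (inr tt).

Definition keep (rd : reads) : acts := [ffun i => (rd i, Stay)].
Definition set_act (k : nat) (a : symb * move) (f : acts) : acts :=
  [ffun i : 'I_W.+1 => if i == k :> nat then a else f i].
Definition scan (rd : reads) (k : nat) : symb := rd (inord k).

Definition on (k : nat) (a : symb -> symb * move) (l : nat) : instr :=
  fun rd => (set_act k (a (scan rd k)) (keep rd), l).

Definition branch (b : reads -> bool) (l1 l2 : nat) : instr :=
  fun rd => (keep rd, if b rd then l1 else l2).

Definition test_reads (b : test) (rd : reads) : bool :=
  match b with
  | IsZero r => scan rd r.+1 == mark
  | IsBit => scan rd 1 == Some (inl true)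
  end.

Fixpoint code_size (c : cmd) : nat :=
  match c with
  | Skip => 0
  | Inc _ | Dec _ | Emit _ => 1
  | Seq c1 c2 => code_size c1 + code_size c2
  | While _ c => (code_size c).+2
  | If _ c1 c2 => (code_size c1 + code_size c2).+2
  end.

(* Register [r] is the head position on tape [r.+1], whose cell 0 is marked. *)
Fixpoint code (c : cmd) (l : nat) : seq instr :=
  match c with
  | Skip => [::]
  | Inc r => [:: on r.+1 (fun s => (s, MoveR)) l.+1]
  | Dec r => [:: on r.+1 (fun s => (s, if s == mark then Stay else MoveL)) l.+1]
  | Emit b => [:: on 0 (fun=> (Some (inl b), MoveR)) l.+1]
  | Seq c1 c2 => code c1 l ++ code c2 (l + code_size c1)
  | While r c =>
      branch (test_reads (IsZero r)) (l + (code_size c).+2) l.+1 ::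
      code c l.+1 ++ [:: branch xpredT l l]
  | If b c1 c2 =>
      branch (test_reads b) l.+1 (l + code_size c1).+2 ::
      code c1 l.+1 ++
      branch xpredT (l + (code_size c1 + code_size c2).+2) 0 ::
      code c2 (l + code_size c1).+2
  end.

Lemma size_code c l : size (code c l) = code_size c.
Proof.
elim: c l => [|r|r|b|c1 IH1 c2 IH2|r c IH|b c1 IH1 c2 IH2] l //=.
- by rewrite size_cat IH1 IH2.
- by rewrite size_cat IH addn1.
- by rewrite size_cat /= IH1 IH2 addnS.
Qed.

Variable prog : seq instr.

(** States are addresses of the program; the additional address [size prog] is the halting state. *)
Definition flat_delta (q : 'I_(size prog).+1) (rd : reads) :
    'I_(size prog).+1 * acts :=
  let d := nth (fun rd => (keep rd, 0)) prog q rd in (inord d.2, d.1).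

Definition flat_TM : TM :=
  @MkTM W unit 'I_(size prog).+1 ord0 (fun q => q == size prog :> nat) flat_delta.

Lemma nth_mid (T : Type) (x0 : T) (p q : seq T) x : nth x0 (p ++ x :: q) (size p) = x.
Proof. by rewrite nth_cat ltnn subnn. Qed.

(** The address [size pre] selects [i], and the bound on the next address makes [inord] exact. *)
Lemma flat_step pre i post (C : config flat_TM) :
  prog = pre ++ i :: post -> C.1 = size pre :> nat ->
  let rd := [ffun k => tape_read (C.2 k)] in (i rd).2 <= size prog ->
  (step C).1 = (i rd).2 :> nat /\
  forall k, (step C).2 k = @tape_act flat_TM ((i rd).1 k) (C.2 k).
Proof.
move=> ep eC rd le.
have nh : ~~ halted C by rewrite /halted /= eC ep size_cat /=; lia.
have ei : nth (fun rd => (keep rd, 0)) prog (size pre) = i by rewrite ep nth_mid.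
rewrite /step (negPf nh) /= /flat_delta eC ei /= inordK //.
by split=> // k; rewrite ffunE.
Qed.

Lemma flat_halted (C : config flat_TM) n :
  C.1 = size prog :> nat -> iter n (@step flat_TM) C = C.
Proof. by move=> e; elim: n => //= n ->; rewrite /step /halted /= e eqxx. Qed.

Variable y : seq bool.

(** The tape of register 0 carries [y] behind the mark, so a cursor value [k.+1] scans the bit of
    index [k]; the tapes of the other registers hold only the mark. *)
Definition reg_word (r : nat) : seq symb :=
  mark :: (if r == 0 then bits_of flat_TM y else [::]).

(* Tape 0 holds the output word, with the head behind it. *)
Definition tape_word (s : regs * seq bool) (k : nat) : seq symb * nat :=
  if k is r.+1 then (reg_word r, s.1 r) else (bits_of flat_TM s.2, size s.2).

Definition represents (l : nat) (s : regs * seq bool) (C : config flat_TM) :=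
  C.1 = l :> nat /\
  forall k, @at_pos flat_TM (C.2 k) (tape_word s k).1 (tape_word s k).2.

Lemma scan_reg l s C r : represents l s C -> r < W ->
  scan [ffun k => tape_read (C.2 k)] r.+1 = nth None (reg_word r) (s.1 r).
Proof.
case=> _ h rW; rewrite /scan ffunE; have := at_pos_read (h (inord r.+1)).
by rewrite inordK //= => ->.
Qed.

Lemma reg_word_mark r p : (nth None (reg_word r) p == mark) = (p == 0).
Proof.
case: p => //= p; case: (r == 0); last by rewrite nth_nil.
case: (ltnP p (size y)) => h; last by rewrite nth_default ?size_map.
by rewrite (nth_map false).
Qed.

Lemma test_readsP l s C b : represents l s C ->
  test_reg b < W ->
  test_reads b [ffun k => tape_read (C.2 k)] = holds y s.1 b.
Proof.
move=> rep; case: b => [r|] rW /=; rewrite (scan_reg rep) //.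
  exact: reg_word_mark.
case: (s.1 0) => //= p.
case: (ltnP p (size y)) => h; last by rewrite !nth_default ?size_map.
by rewrite (nth_map false) //; case: nth.
Qed.

Lemma represents_branch pre post l1 l2 b s C l' :
  prog = pre ++ branch b l1 l2 :: post -> represents (size pre) s C ->
  l' = (if b [ffun k => tape_read (C.2 k)] then l1 else l2) ->
  l' <= size prog -> represents l' s (step C).
Proof.
move=> ep [e h] -> le; have [] := flat_step ep e le => e' h'.
by split=> // k; rewrite h' /= !ffunE; apply: at_pos_stay.
Qed.

Lemma represents_on pre post k0 a s s' C :
  prog = pre ++ on k0 a (size pre).+1 :: post -> represents (size pre) s C ->
  k0 <= W ->
  (forall k, k != k0 -> tape_word s' k = tape_word s k) ->
  (forall t : tape flat_TM, @at_pos flat_TM t (tape_word s k0).1 (tape_word s k0).2 ->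
     @at_pos flat_TM (@tape_act flat_TM (a (tape_read t)) t)
       (tape_word s' k0).1 (tape_word s' k0).2) ->
  represents (size pre).+1 s' (step C).
Proof.
move=> ep [e h] k0W ne eq; have := flat_step ep e.
case=> [|e' h']; first by rewrite /= ep size_cat /=; lia.
split=> // k; rewrite h' /= !ffunE.
case: (eqVneq (k : nat) k0) => kk; last by rewrite ne //; apply: at_pos_stay.
have -> : scan [ffun k1 => tape_read (C.2 k1)] k0 = tape_read (C.2 k).
  by rewrite /scan ffunE -kk inord_val.
by rewrite kk; apply: eq; rewrite -kk.
Qed.

Lemma tape_word_upd s r v o k : k != r.+1 ->
  tape_word (upd s r v, o) k = tape_word (s, o) k.
Proof. by case: k => //= k; rewrite eqSS /upd => /negPf ->. Qed.

(** Induction on the execution. The surrounding code [pre] and [post] is arbitrary, so that the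
    hypothesis applies to fragments at any address. *)
Lemma code_correct c s t s' : exec y c s t s' -> max_reg c < W ->
  forall pre post, prog = pre ++ code c (size pre) ++ post ->
  forall C, represents (size pre) s C ->
    represents (size pre + code_size c) s' (iter t (@step flat_TM) C).
Proof.
elim=> {c s t s'}.
- by move=> s _ pre post _ C; rewrite addn0.
- move=> r s o rW pre post e C rep; rewrite addn1 /=.
  apply: represents_on e rep rW _ _ => [k kr|tp /= /at_pos_right].
    by rewrite tape_word_upd.
  by rewrite /upd eqxx.
- move=> r s o rW pre post e C rep; rewrite addn1 /=.
  apply: represents_on e rep rW _ _ => [k kr|tp h /=].
    by rewrite tape_word_upd.
  rewrite /upd eqxx; move: (h) => /= /at_pos_read ->; rewrite reg_word_mark.
  move: h => /=; case: (s r) => [|p] /= h.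
    by have := at_pos_stay h; rewrite (at_pos_read h).
  by have := at_pos_left h; rewrite (at_pos_read h).
- move=> b s o _ pre post e C rep; rewrite addn1 /=.
  apply: represents_on e rep _ _ _ => // [[]//|tp /=].
  have := @at_pos_append flat_TM tp (bits_of flat_TM o) (Some (inl b)).
  by rewrite /bits_of map_rcons size_map size_rcons.
- move=> c1 c2 s1 s2 s3 t1 t2 _ IH1 _ IH2 /=; rewrite gtn_max => /andP[m1 m2].
  move=> pre post e C rep; rewrite (addnC t1) iterD addnA.
  have := IH2 m2 (pre ++ code c1 (size pre)) post.
  rewrite size_cat size_code; apply; first by rewrite e !catA.
  by apply: (IH1 m1 pre (code c2 (size pre + code_size c1) ++ post)) => //; rewrite e !catA.
- move=> r c s s0 /=; rewrite gtn_max => /andP[rW _] pre post e C rep /=.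
  have ts := @test_readsP _ _ _ (IsZero r) rep rW.
  apply: (represents_branch e rep); first by rewrite ts /= s0.
  by rewrite e !size_cat /= !size_cat size_code /=; lia.
- move=> r c s1 s2 s3 t1 t2 s0 _ IH1 _ IH2 max pre post e C rep.
  have /andP[rW cW] : (r < W) && (max_reg c < W) by rewrite -gtn_max.
  have ts := @test_readsP _ _ _ (IsZero r) rep rW.
  have sz : size prog = size pre + (code_size c).+2 + size post.
    by rewrite e !size_cat /= !size_cat size_code /=; lia.
  have st1 : represents (size pre).+1 s1 (step C).
    apply: (represents_branch e rep); first by rewrite ts /= (negPf s0).
    by rewrite sz; lia.
  (* In order of time: one step for the test, [t1] for the body, one for the jump back, and [t2] for
     the remaining rounds. *)
  rewrite (_ : (t1 + t2).+2 = t2 + (t1.+1).+1); last by lia.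
  rewrite iterD; apply: (IH2 max pre post e); rewrite iterS iterSr.
  set i0 := branch (test_reads (IsZero r)) (size pre + (code_size c).+2) (size pre).+1.
  have := IH1 cW (rcons pre i0) (branch xpredT (size pre) (size pre) :: post).
  rewrite size_rcons => st2.
  apply: (@represents_branch (rcons pre i0 ++ code c (size pre).+1) post
            (size pre) (size pre) xpredT).
  + by rewrite e cat_rcons /= -!catA.
  + rewrite size_cat size_rcons size_code.
    by apply: st2 st1; rewrite e cat_rcons /= -catA.
  + by [].
  + by rewrite sz; lia.
- move=> b c1 c2 s1 s2 t bs _ IH max pre post e C rep.
  have /and3P[bW c1W c2W] : [&& test_reg b < W, max_reg c1 < W & max_reg c2 < W].
    by rewrite -!gtn_max.
  have ts := test_readsP rep bW.
  have sz : size prog = size pre + (code_size c1 + code_size c2).+2 + size post.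
    by rewrite e !size_cat /= !size_cat /= !size_code /=; lia.
  have st1 : represents (size pre).+1 s1 (step C).
    apply: (represents_branch e rep); first by rewrite ts bs.
    by rewrite sz; lia.
  rewrite iterS iterSr /=.
  set i0 := branch (test_reads b) (size pre).+1 (size pre + code_size c1).+2.
  set i1 := branch xpredT (size pre + (code_size c1 + code_size c2).+2) 0.
  have := IH c1W (rcons pre i0) (i1 :: code c2 (size pre + code_size c1).+2 ++ post).
  rewrite size_rcons => st2.
  apply: (@represents_branch (rcons pre i0 ++ code c1 (size pre).+1)
            (code c2 (size pre + code_size c1).+2 ++ post)
            (size pre + (code_size c1 + code_size c2).+2) 0 xpredT).
  + by rewrite e cat_rcons /= -!catA.
  + rewrite size_cat size_rcons size_code.
    by apply: st2 st1; rewrite e cat_rcons /= -catA.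
  + by [].
  + by rewrite sz; lia.
- move=> b c1 c2 s1 s2 t bs _ IH max pre post e C rep.
  have /and3P[bW c1W c2W] : [&& test_reg b < W, max_reg c1 < W & max_reg c2 < W].
    by rewrite -!gtn_max.
  have ts := test_readsP rep bW.
  have sz : size prog = size pre + (code_size c1 + code_size c2).+2 + size post.
    by rewrite e !size_cat /= !size_cat /= !size_code /=; lia.
  have st1 : represents (size pre + code_size c1).+2 s1 (step C).
    apply: (represents_branch e rep); first by rewrite ts (negPf bs).
    by rewrite sz; lia.
  rewrite iterSr /=.
  set i0 := branch (test_reads b) (size pre).+1 (size pre + code_size c1).+2.
  set i1 := branch xpredT (size pre + (code_size c1 + code_size c2).+2) 0.
  have := IH c2W (rcons pre i0 ++ rcons (code c1 (size pre).+1) i1) post.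
  rewrite size_cat !size_rcons size_code.
  rewrite (_ : (size pre).+1 + (code_size c1).+1 = (size pre + code_size c1).+2); last by lia.
  rewrite (_ : size pre + (code_size c1 + code_size c2).+2 =
    (size pre + code_size c1).+2 + code_size c2); last by lia.
  by apply=> //; rewrite e cat_rcons /= -!catA /= cat_rcons.
Qed.

End Compile.

(** * Polynomially bounded functions *)

Definition poly_bounded (f : nat -> nat) :=
  exists c d, forall n, f n <= c * n.+1 ^ d.

Lemma poly_bounded_const k : poly_bounded (fun=> k).
Proof. by exists k, 0 => n; rewrite muln1. Qed.

Lemma poly_bounded_id : poly_bounded id.
Proof. by exists 1, 1 => n; rewrite mul1n expn1. Qed.

(** The base [n.+1] is positive, so both exponents can be raised to their sum. *)
Lemma poly_boundedD f g :
  poly_bounded f -> poly_bounded g -> poly_bounded (fun n => f n + g n).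
Proof.
move=> [c [d hf]] [c' [d' hg]]; exists (c + c'), (d + d') => n.
rewrite mulnDl; apply: leq_add; [apply: leq_trans (hf n) _|apply: leq_trans (hg n) _];
  by rewrite leq_mul2l leq_pexp2l ?orbT // ?leq_addr ?leq_addl.
Qed.

Lemma poly_boundedM f g :
  poly_bounded f -> poly_bounded g -> poly_bounded (fun n => f n * g n).
Proof.
move=> [c [d hf]] [c' [d' hg]]; exists (c * c'), (d + d') => n.
by rewrite expnD mulnACA leq_mul.
Qed.

Lemma leq_expl m n e : m <= n -> m ^ e <= n ^ e.
Proof. by case: e => // e; rewrite leq_exp2r. Qed.

Lemma poly_bounded_comp f g :
  poly_bounded f -> poly_bounded g -> poly_bounded (fun n => f (g n)).
Proof.
move=> [c [d hf]] [c' [d' hg]]; exists (c * c'.+1 ^ d), (d' * d) => n.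
apply: leq_trans (hf _) _; rewrite -mulnA leq_mul2l expnM -expnMn; apply/orP; right.
apply: leq_expl; by rewrite mulSn -add1n leq_add ?expn_gt0.
Qed.

(** For positive [n], [n.+1] is at most [2 * n], which costs the factor [2 ^ d]; the additive
    constant takes care of [n = 0]. *)
Lemma poly_bounded_poly_bound f : poly_bounded f ->
  exists c d, forall n, f n <= poly_bound c d n.
Proof.
move=> [c [d h]]; exists (c * 2 ^ d), d => n; apply: leq_trans (h n) _.
rewrite /poly_bound -mulnA -expnMn; case: n => [|n].
  by rewrite exp1n muln1; apply: leq_trans (leq_addl _ _); rewrite leq_pmulr ?expn_gt0.
apply: leq_trans (leq_addr _ _); rewrite leq_mul2l; apply/orP; right.
by apply: leq_expl; lia.
Qed.

(** A step emits at most one bit. This bounds the time for rewinding the output tape. *)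
Lemma exec_output y c s t s' : exec y c s t s' -> size s'.2 <= size s.2 + t.
Proof.
elim=> {c s t s'} //=; try by move=> *; lia.
by move=> b s o; rewrite size_rcons addn1.
Qed.

(** * The complete machine: prologue, program, epilogue *)

Section Machine.
Variable c : cmd.

(** Above every register of [c], and at least 2, so that tapes 1 and 2, which the prologue fills,
    exist. *)
Let W := (max_reg c).+2.
Local Notation symb := (option (bool + unit)).
Local Notation reads := {ffun 'I_W.+1 -> symb}.
Local Notation acts := {ffun 'I_W.+1 -> symb * move}.

(* The prologue replaces the input [x] on tape 0 by [delimit x] on tape 1, and
   moves the head of tape 2 to cell [size x]. *)
Definition pro0 : instr W := fun rd =>
  ([ffun i : 'I_W.+1 => if i == 0 :> nat then (rd i, Stay)
     else (mark, if i == 1 :> nat then MoveR else Stay)], 1).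

(** On a bit it writes the [true] that precedes this bit in [delimit]; on the blank behind the input
    it writes the closing [false]. *)
Definition pro1 : instr W := fun rd =>
  if scan rd 0 is Some (inl b)
  then (set_act 1 (Some (inl true), MoveR) (keep rd), 2)
  else (set_act 1 (Some (inl false), MoveR) (keep rd), 3).

Definition pro2 : instr W := fun rd =>
  (set_act 0 (None, MoveR) (set_act 1 (scan rd 0, MoveR)
     (set_act 2 (scan rd 2, MoveR) (keep rd))), 1).

(* The epilogue moves the head of tape 0 back to the beginning of the output. *)
Definition epi0 (l : nat) : instr W := on 0 (fun s => (s, MoveL)) l.+1.

(** Runs left over the output to the blank cell before it, then makes one step right onto the first
    letter. *)
Definition epi1 (l : nat) : instr W := fun rd =>
  if scan rd 0 is Some _
  then (set_act 0 (scan rd 0, MoveL) (keep rd), l)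
  else (set_act 0 (scan rd 0, MoveR) (keep rd), l.+1).

Let fin := code_size c + 3.
Definition cmd_prog : seq (instr W) :=
  [:: pro0; pro1; pro2] ++ code W c 3 ++ [:: epi0 fin; epi1 fin.+1].

Local Notation M := (flat_TM cmd_prog).

Lemma size_cmd_prog : size cmd_prog = fin.+2.
Proof. by rewrite /cmd_prog size_cat /= size_cat size_code /= /fin; lia. Qed.

(** Here [u] is the input still on tape 0, [z] the word already on tape 1, and [k] the number of
    bits counted on tape 2. *)
Definition in_prologue (l : nat) (u z : seq bool) (k : nat) (C : config M) :=
  C.1 = l :> nat /\ forall i, @at_pos M (C.2 i)
    (match val i with 0 => bits_of M u | 1 => mark :: bits_of M z | _ => [:: mark] end)
    (match val i with 0 => 0 | 1 => (size z).+1 | 2 => k | _ => 0 end).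

Lemma scan_prologue l u z k C : in_prologue l u z k C ->
  scan [ffun i => tape_read (C.2 i)] 0 = omap inl (ohead u).
Proof.
case=> _ h; rewrite /scan ffunE; have := at_pos_read (h (inord 0)).
by rewrite /= inordK //= => ->; case: u {h}.
Qed.

Lemma at_pos_snoc t (z : seq bool) b : @at_pos M t (mark :: bits_of M z) (size z).+1 ->
  @at_pos M (tape_act (Some (inl b), MoveR) t)
    (mark :: bits_of M (rcons z b)) (size (rcons z b)).+1.
Proof.
have := @at_pos_append M t (mark :: bits_of M z) (Some (inl b)).
by rewrite /= size_map size_rcons /bits_of map_rcons.
Qed.

Lemma prologue_loop u z k C : in_prologue 1 u z k C ->
  in_prologue 3 [::] (z ++ delimit u) (k + size u) (iter (size u).*2.+1 (@step M) C).
Proof.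
elim: u z k C => [|b u IH] z k C inv.
- have r0 := scan_prologue inv; case: inv => e h.
  have := @flat_step W cmd_prog [:: pro0] pro1 _ C erefl e.
  rewrite /= /pro1 r0 /= => -[|e' h'] //=.
  split=> // i; rewrite h' /= !ffunE.
  have := h i; case: i => [[|[|[|i]]] ilt] /= hi.
  + exact: at_pos_stay.
  + by rewrite cats1; exact: at_pos_snoc.
  + by rewrite addn0; exact: at_pos_stay.
  + exact: at_pos_stay.
- have inv1 : in_prologue 2 (b :: u) (rcons z true) k (step C).
    have r0 := scan_prologue inv; case: inv => e h.
    have := @flat_step W cmd_prog [:: pro0] pro1 _ C erefl e.
    rewrite /= /pro1 r0 /= => -[|e' h'] //=.
    split=> // i; rewrite h' /= !ffunE.
    have := h i; case: i => [[|[|[|i]]] ilt] /= hi; try exact: at_pos_stay.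
    exact: at_pos_snoc.
  have inv2 : in_prologue 1 u (rcons (rcons z true) b) k.+1 (step (step C)).
    have r0 := scan_prologue inv1; case: inv1 => e h.
    have := @flat_step W cmd_prog [:: pro0; pro1] pro2 _ (step C) erefl e.
    rewrite /= r0 /= => -[|e' h'] //=.
    split=> // i; rewrite h' /= !ffunE.
    have := h i; case: i => [[|[|[|i]]] ilt] /= hi.
    + exact: at_pos_erase hi.
    + exact: at_pos_snoc.
    + have -> : scan [ffun i => tape_read ((step C).2 i)] 2 =
                tape_read ((step C).2 (Ordinal ilt)).
        rewrite /scan ffunE (_ : inord 2 = Ordinal ilt) //.
        by apply: val_inj; rewrite /= inordK.
      exact: at_pos_right.
    + exact: at_pos_stay.
  rewrite addnS -addSn (_ : z ++ delimit (b :: u) = rcons (rcons z true) b ++ delimit u).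
    by rewrite doubleS iterSr iterSr; apply: IH.
  by rewrite !cat_rcons.
Qed.

(** The prologue leaves the cursor behind the delimited input, one further than its length because
    cell 0 is the mark. *)
Definition init_regs (x : seq bool) : regs :=
  fun r => match r with 0 => (size (delimit x)).+1 | 1 => size x | _ => 0 end.

Lemma prologue x :
  represents (delimit x) 3 (init_regs x, [::]) (iter (size x).*2.+2 (@step M) (init M x)).
Proof.
have inv : in_prologue 1 x [::] 0 (step (init M x)).
  have := @flat_step W cmd_prog [::] pro0 _ (init M x) erefl erefl.
  case=> [|e' h'] //=.
  split=> // i; rewrite h' /= !ffunE.
  case: i => [[|[|[|i]]] ilt] /=.
  + apply: at_pos_stay; exact: at_pos_init.
  + by have := @at_pos_append M ([::], [::]) [::] mark (@at_pos_init M [::]).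
  + exact/at_pos_write/at_pos_init.
  + exact/at_pos_write/at_pos_init.
have := prologue_loop inv; rewrite -iterSr => -[e h]; split=> // i.
by have := h i; case: i => [[|[|[|i]]] ilt].
Qed.

Lemma epi0_step (C : config M) : C.1 = fin :> nat ->
  let rd := [ffun k => tape_read (C.2 k)] in
  (step C).1 = fin.+1 :> nat /\
  forall k, (step C).2 k = @tape_act M ((epi0 fin rd).1 k) (C.2 k).
Proof.
move=> e; apply: (@flat_step W cmd_prog ([:: pro0; pro1; pro2] ++ code W c 3)
  (epi0 fin) [:: epi1 fin.+1]).
- by rewrite /cmd_prog -?catA.
- by rewrite e size_cat size_code /= /fin; lia.
- by rewrite size_cmd_prog.
Qed.

Lemma epi1_step (C : config M) : C.1 = fin.+1 :> nat ->
  let rd := [ffun k => tape_read (C.2 k)] in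
  (step C).1 = (epi1 fin.+1 rd).2 :> nat /\
  forall k, (step C).2 k = @tape_act M ((epi1 fin.+1 rd).1 k) (C.2 k).
Proof.
move=> e; apply: (@flat_step W cmd_prog ([:: pro0; pro1; pro2] ++ code W c 3 ++
  [:: epi0 fin]) (epi1 fin.+1) [::]).
- by rewrite /cmd_prog -?catA.
- by rewrite e !size_cat size_code /= /fin; lia.
- by rewrite size_cmd_prog /epi1; case: scan.
Qed.

(** The head scans the letter of index [p - 1] of the output; for [p = 0] it has reached the blank
    before the word. *)
Lemma epilogue_loop (o : seq bool) p (C : config M) :
  C.1 = fin.+1 :> nat ->
  (forall j, cell (C.2 ord0) j = word_cell (bits_of M o) (j + p%:Z - 1)%R) -> p <= size o ->
  let C' := iter p.+1 (@step M) C in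
  C'.1 = fin.+2 :> nat /\ @at_pos M (C'.2 ord0) (bits_of M o) 0.
Proof.
elim: p C => [|p IH] C e h po.
- have r0 : scan [ffun i => tape_read (C.2 i)] 0 = None.
    rewrite /scan ffunE tape_readE (_ : inord 0 = ord0) ?h //.
    by apply: val_inj; rewrite /= inordK.
  have [] := epi1_step e; rewrite /epi1 r0.
  move=> e' h'; split; first by rewrite e'.
  move=> j; rewrite h' /= !ffunE /=.
  have -> : None = tape_read (C.2 ord0).
    by rewrite -r0 /scan ffunE (_ : inord 0 = ord0) //; apply: val_inj; rewrite /= inordK.
  by rewrite cell_move h; congr word_cell; rewrite /=; lia.
- have rE : scan [ffun i => tape_read (C.2 i)] 0 = tape_read (C.2 ord0).
    by rewrite /scan ffunE (_ : inord 0 = ord0) //; apply: val_inj; rewrite /= inordK.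
  have r0 : scan [ffun i => tape_read (C.2 i)] 0 = Some (inl (nth false o p)).
    rewrite rE tape_readE h (_ : (0 + p.+1%:Z - 1)%R = Posz p) /=; last by lia.
    by rewrite (nth_map false).
  have [] := epi1_step e; rewrite /epi1 r0.
  move=> e' h'.
  rewrite iterSr; apply: IH (ltnW po).
    by rewrite e'.
  move=> j; rewrite h' /= !ffunE /= -r0 rE.
  by rewrite cell_move h; congr word_cell; rewrite /=; lia.
Qed.

(** The prologue takes [(size x).*2.+2] steps, the program [t], and the epilogue [(size o).+2],
    where [size o <= t]. Afterwards the machine stays halted. *)
Lemma cmd_run x t s o : exec (delimit x) c (init_regs x, [::]) t (s, o) ->
  forall n, (size x).*2 + t.*2 + 4 <= n ->
  let C := iter n (@step M) (init M x) in halted C /\ output C = o.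
Proof.
move=> ex n le_n C; have so := exec_output ex; rewrite add0n /= in so.
have rep := @code_correct W cmd_prog _ c _ _ _ ex _ [:: pro0; pro1; pro2]
  [:: epi0 fin; epi1 fin.+1] erefl _ (prologue x).
have {rep}[|e h] := rep; first by rewrite /W; lia.
set C1 := iter t _ _ in e h.
have e1 : C1.1 = fin :> nat by rewrite e /fin addnC.
have [e2 h2] := epi0_step e1.
have := @epilogue_loop o (size o) (step C1) e2 => -[j||eC hC] //.
  have rE : scan [ffun i => tape_read (C1.2 i)] 0 = tape_read (C1.2 ord0).
    by rewrite /scan ffunE (_ : inord 0 = ord0) //; apply: val_inj; rewrite /= inordK.
  rewrite h2 /= !ffunE /= rE cell_move (h ord0) /=.
  by congr word_cell; rewrite /=; lia.
set C2 := iter _ _ _ in eC hC.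
have -> : C = C2.
  have -> : C = iter (n - ((size o).+2 + (t + (size x).*2.+2))) (@step M) C2.
    rewrite /C /C2 -iterSr /C1 -!iterD; congr iter.
    by move: le_n so; rewrite -!addnn; lia.
  by apply: flat_halted; rewrite eC size_cmd_prog.
split; first by rewrite -[halted _]/(C2.1 == size cmd_prog :> nat) eC size_cmd_prog.
exact: bits_prefix_at hC.
Qed.

End Machine.

Lemma cmd_polytime (c : cmd) (f : seq bool -> seq bool) (g : nat -> nat) :
  poly_bounded g ->
  (forall x, exists2 t, t <= g (size x) &
     exists s, exec (delimit x) c (init_regs x, [::]) t (s, f x)) ->
  polytime f.
Proof.
move=> pg h.
have [|a [d le]] := @poly_bounded_poly_bound (fun n => n + n + (g n + g n) + 4).
  by do !apply: poly_boundedD; try exact: poly_bounded_id; try exact: pg;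
     apply: poly_bounded_const.
exists (flat_TM (cmd_prog c)), a, d => x; have [t tg [s ex]] := h x.
apply: (cmd_run ex); apply: leq_trans (le _).
by rewrite -!addnn; lia.
Qed.

(** * Arithmetic expressions *)

(** From here on upper bounds on the time suffice; they compose without exact step counts. *)
Definition exec_in y c s T s' := exists2 t, t <= T & exec y c s t s'.

Ltac regs_eq := let i := fresh "i" in move=> i; rewrite /= /upd ?eqxx;
  do ?[case: eqP => ? //]; subst; try lia.

Section Rules.
Variable y : seq bool.

Lemma exec_in_le c s T T' s' : T <= T' -> exec_in y c s T s' -> exec_in y c s T' s'.
Proof. by move=> le [t tT ex]; exists t => //; lia. Qed.

Lemma exec_in_eq c s T s1 s2 o : s1 =1 s2 ->
  exec_in y c s T (s1, o) -> exec_in y c s T (s2, o).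
Proof. by move=> /functional_extensionality ->. Qed.

Lemma exec_in_skip s T : exec_in y Skip s T s.
Proof. by exists 0 => //; constructor. Qed.

Lemma exec_in_inc r s o : exec_in y (Inc r) (s, o) 1 (upd s r (s r).+1, o).
Proof. by exists 1 => //; constructor. Qed.

Lemma exec_in_dec r s o : exec_in y (Dec r) (s, o) 1 (upd s r (s r).-1, o).
Proof. by exists 1 => //; constructor. Qed.

Lemma exec_in_emit b s o : exec_in y (Emit b) (s, o) 1 (s, rcons o b).
Proof. by exists 1 => //; constructor. Qed.

Lemma exec_in_seq c1 c2 s1 s2 s3 T1 T2 :
  exec_in y c1 s1 T1 s2 -> exec_in y c2 s2 T2 s3 ->
  exec_in y (Seq c1 c2) s1 (T1 + T2) s3.
Proof.
by move=> [t1 l1 e1] [t2 l2 e2]; exists (t1 + t2); [lia | apply: ESeq e1 e2].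
Qed.

Lemma exec_in_if b c1 c2 s s' T :
  exec_in y (if holds y s.1 b then c1 else c2) s T s' ->
  exec_in y (If b c1 c2) s (T + 2) s'.
Proof.
case E: (holds y s.1 b) => -[t l e].
  by exists t.+2; [lia | apply: EIfT].
by exists t.+1; [lia | apply: EIfF => //; rewrite E].
Qed.

Lemma exec_in_while0 r c s T : s.1 r = 0 -> 0 < T -> exec_in y (While r c) s T s.
Proof. by move=> e le; exists 1 => //; apply: EWhile0. Qed.

Lemma exec_in_whileS r c s1 s2 s3 T1 T2 : s1.1 r != 0 ->
  exec_in y c s1 T1 s2 -> exec_in y (While r c) s2 T2 s3 ->
  exec_in y (While r c) s1 (T1 + T2).+2 s3.
Proof.
by move=> e [t1 l1 e1] [t2 l2 e2]; exists (t1 + t2).+2; [lia | apply: EWhileS e1 e2].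
Qed.

(* [S k] is the state with [k] iterations to go. *)
Lemma exec_in_while r c (S : nat -> regs * seq bool) n T :
  (S 0).1 r = 0 ->
  (forall k, k < n -> (S k.+1).1 r != 0 /\ exec_in y c (S k.+1) T (S k)) ->
  exec_in y (While r c) (S n) (n * (T + 2) + 1) (S 0).
Proof.
move=> S0; elim: n => [|n IH] h; first exact: exec_in_while0.
have [nz ex] := h _ (ltnSn n).
apply: exec_in_le (exec_in_whileS nz ex (IH _)); first by rewrite mulSn; lia.
by move=> k kn; apply: h; lia.
Qed.

Lemma exec_in_clear r s o n : s r <= n ->
  exec_in y (While r (Dec r)) (s, o) (n * 3 + 1) (upd s r 0, o).
Proof.
move=> le; pose S k := (upd s r k, o).
have -> : (s, o) = S (s r).
  by congr pair; apply: functional_extensionality => i; rewrite /upd; case: eqP => [->|].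
apply: exec_in_le (@exec_in_while r _ S (s r) 1 _ _); first by lia.
- by rewrite /= /upd eqxx.
- move=> k _; rewrite /S /= {1}/upd eqxx; split=> //.
  by apply: exec_in_eq (exec_in_dec _ _ _); regs_eq.
Qed.

End Rules.

(** * Evaluation of expressions by counter programs *)

Inductive expr :=
| Var of nat
| Cst of nat
| Add of expr & expr
| Mul of expr & expr
| Minus of expr & expr
| Bit of expr.

Section Expr.
Variable y : seq bool.

(* Variables are de Bruijn indices into the environment. *)
Fixpoint eval (env : seq nat) (e : expr) : nat :=
  match e with
  | Var i => nth 0 env i
  | Cst c => c
  | Add a b => eval env a + eval env b
  | Mul a b => eval env a * eval env b
  | Minus a b => eval env a - eval env b
  | Bit a => nth false y (eval env a)
  end.

(** Polynomial in the bound [N] on the variables; loop lengths, and through them running times, are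
    estimated by it. *)
Fixpoint val_bound (e : expr) (N : nat) : nat :=
  match e with
  | Var i => N
  | Cst c => c
  | Add a b => val_bound a N + val_bound b N
  | Mul a b => val_bound a N * val_bound b N
  | Minus a b => val_bound a N
  | Bit a => 1
  end.

Lemma eval_bound env e N : all (geq N) env -> eval env e <= val_bound e N.
Proof.
move=> h; elim: e => //= [i|a IHa b IHb|a IHa b IHb|a IHa b IHb|a IHa].
- case: (ltnP i (size env)) => hi; last by rewrite nth_default.
  exact: (allP h _ (mem_nth 0 hi)).
- exact: leq_add.
- exact: leq_mul.
- exact: leq_trans (leq_subr _ _) IHa.
- by case: nth.
Qed.

(* Adds the value of [e] to register [r], where variable [i] is in register
   [nth 0 rho i]; the registers from [d] on are scratch, and contain 0. *)
Fixpoint add_to (e : expr) (rho : seq nat) (d r : nat) : cmd :=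
  match e with
  | Var i =>
      if i < size rho then
        let v := nth 0 rho i in
        Seq (While v (Seq (Dec v) (Seq (Inc r) (Inc d))))
            (While d (Seq (Dec d) (Inc v)))
      else Skip
  | Cst c => iter c (Seq (Inc r)) Skip
  | Add a b => Seq (add_to a rho d r) (add_to b rho d r)
  | Mul a b =>
      Seq (add_to a rho d.+1 d) (While d (Seq (Dec d) (add_to b rho d.+1 r)))
  | Minus a b =>
      Seq (add_to a rho d.+1 d)
     (Seq (add_to b rho d.+2 d.+1)
     (Seq (While d.+1 (Seq (Dec d.+1) (Dec d)))
          (While d (Seq (Dec d) (Inc r)))))
  | Bit a =>
      Seq (add_to a rho d.+1 d)
     (Seq (While d (Seq (Dec d) (Seq (Inc 0) (Inc d.+1))))
     (Seq (Inc 0)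
     (Seq (If IsBit (Inc r) Skip)
     (Seq (Dec 0)
          (While d.+1 (Seq (Dec d.+1) (Dec 0)))))))
  end.

Fixpoint time_bound (e : expr) (N : nat) : nat :=
  match e with
  | Var i => N * 9 + 2
  | Cst c => c
  | Add a b => time_bound a N + time_bound b N
  | Mul a b => time_bound a N + (val_bound a N * (time_bound b N + 3) + 1)
  | Minus a b => time_bound a N + (time_bound b N +
                 (val_bound b N * 4 + 1 + (val_bound a N * 4 + 1)))
  | Bit a => time_bound a N + (val_bound a N * 9 + 7)
  end.

(** The invariant between commands: the cursor is back at 0, scratch registers are empty, and the
    variables lie strictly between the two. *)
Definition scratch (s : regs) (rho : seq nat) (d : nat) :=
  [/\ 0 < d, s 0 = 0, forall i, d <= i -> s i = 0 & {in rho, forall v, 0 < v < d}].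

Lemma scratch_target s rho d r : scratch s rho d -> r < d -> 0 < r ->
  forall n, scratch (upd s r n) rho d.
Proof.
move=> [d0 s0 sd rd] rlt r0 n; split=> //; first by rewrite /upd; case: eqP => //; lia.
by move=> i di; rewrite /upd; case: eqP => [|_]; [lia | apply: sd].
Qed.

Lemma scratch_next s rho d n : scratch s rho d -> scratch (upd s d n) rho d.+1.
Proof.
move=> [d0 s0 sd rd]; split=> //; first by rewrite /upd; case: eqP => //; lia.
- by move=> i di; rewrite /upd; case: eqP => [|_]; [lia | apply: sd; lia].
- by move=> v /rd /andP[-> /ltnW].
Qed.

Lemma scratch_weak s rho d : scratch s rho d -> scratch s rho d.+1.
Proof.
move=> [d0 s0 sd rd]; split=> //; first by move=> i di; apply: sd; lia.
by move=> v /rd /andP[-> /ltnW].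
Qed.

Lemma map_upd s rho r n : r \notin rho -> map (upd s r n) rho = map s rho.
Proof.
move=> h; apply/eq_in_map => i irho; rewrite /upd; case: eqP => // e.
by rewrite -e irho in h.
Qed.

Lemma scratch_notin s rho d r : scratch s rho d -> d <= r -> r \notin rho.
Proof. by case=> _ _ _ h dr; apply/negP => /h; lia. Qed.

(** Induction on [e]. Only the target changes: every scratch register, and the cursor, is back at 0
    at the end, and every variable is restored. *)
Lemma add_to_correct e rho d r s o N :
  scratch s rho d -> r < d -> 0 < r -> r \notin rho -> all (geq N) (map s rho) ->
  exec_in y (add_to e rho d r) (s, o) (time_bound e N)
    (upd s r (s r + eval (map s rho) e), o).
Proof.
elim: e rho d r s =>
  [i|c|a IHa b IHb|a IHa b IHb|a IHa b IHb|a IHa] rho d r s sc rd r0 rr sN /=.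
- case: ltnP => hi; last first.
    by apply: exec_in_eq (exec_in_skip _ _ _); rewrite nth_default ?size_map //; regs_eq.
  rewrite (nth_map 0) //; set v := nth 0 rho i.
  have vin : v \in rho by apply: mem_nth.
  have vN : s v <= N by apply: (allP sN); apply: map_f.
  case: sc => d0 s0 sd /(_ _ vin)/andP[v0 vd].
  have vr : v <> r by move=> e; rewrite -e vin in rr.
  have sd0 := sd d (leqnn d).
  (* Reading a variable destroys it, so it is moved to [r] and to [d] at once, and then restored
     from [d]; [S1] and [S2] describe the two loops. *)
  pose S1 k := (upd (upd (upd s v k) r (s r + (s v - k))) d (s v - k), o).
  pose S2 k := (upd (upd (upd s v (s v - k)) r (s r + s v)) d k, o).
  have e1 : (s, o) = S1 (s v).
    by congr pair; apply: functional_extensionality; regs_eq.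
  have e2 : S1 0 = S2 (s v).
    by congr pair; apply: functional_extensionality; regs_eq.
  have e3 : S2 0 = (upd s r (s r + s v), o).
    by congr pair; apply: functional_extensionality; regs_eq.
  rewrite -e3 {1}e1.
  apply: exec_in_le (exec_in_seq (exec_in_while (S := S1) (T := 3) _ _) _); last first.
  + rewrite e2; apply: (exec_in_while (S := S2) (T := 2)).
      by rewrite /= /upd eqxx.
    move=> k kn; split; first by rewrite /= /upd eqxx.
    apply: exec_in_eq (exec_in_seq (exec_in_dec _ _ _ _) (exec_in_inc _ _ _ _)).
    by regs_eq.
  + move=> k kn; split; first by rewrite /S1 /= /upd; do ?case: eqP => //; lia.
    apply: exec_in_eq (exec_in_seq (exec_in_dec _ _ _ _)
      (exec_in_seq (exec_in_inc _ _ _ _) (exec_in_inc _ _ _ _))).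
    by regs_eq.
  + by rewrite /S1 /= /upd; do ?case: eqP => //; lia.
  + by lia.
- elim: c s {sc sN} => [|c IH] s /=.
    by apply: exec_in_eq (exec_in_skip _ _ _); regs_eq.
  apply: exec_in_eq (exec_in_seq (exec_in_inc _ _ _ _) (IH _)).
  by regs_eq.
- apply: exec_in_eq (exec_in_seq (IHa _ _ _ _ sc rd r0 rr sN) (IHb _ _ _ _ _ rd r0 rr _)).
  + by rewrite map_upd //; regs_eq.
  + exact: scratch_target.
  + by rewrite map_upd.
- have [_ _ sd _] := sc; have sd0 := sd d (leqnn d).
  have dr := scratch_notin sc (leqnn d).
  set A := eval _ a; set B := eval _ b.
  have AN : A <= val_bound a N by apply: eval_bound.
  (* Register [d] counts the additions of [B] that are still to be made. *)
  pose S k := (upd (upd s r (s r + (A - k) * B)) d k, o).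
  have e1 : (upd s d (s d + A), o) = S A.
    by congr pair; apply: functional_extensionality; rewrite /= subnn; regs_eq.
  have e2 : S 0 = (upd s r (s r + A * B), o).
    by congr pair; apply: functional_extensionality; rewrite subn0; regs_eq.
  rewrite -e2; apply: exec_in_seq (IHa _ _ _ _ (scratch_weak sc) _ _ dr sN) _.
  + exact: ltnSn.
  + by case: sc.
  rewrite -/A e1; apply: exec_in_le (exec_in_while (S := S) (T := 1 + time_bound b N) _ _).
  + by rewrite addnAC leq_add2r leq_mul //; lia.
  + by rewrite /= /upd eqxx.
  move=> k kA; split; first by rewrite /= /upd eqxx.
  have sc' n m : scratch (upd (upd s r n) d m) rho d.+1.
    by apply/scratch_next/scratch_target.
  have e3 : (upd (S k.+1).1 d ((S k.+1).1 d).-1) = upd (upd s r (s r + (A - k.+1) * B)) d k.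
    by apply: functional_extensionality; regs_eq.
  apply: exec_in_seq (exec_in_dec _ _ _ _) _; rewrite [upd _ _ _.-1]e3.
  apply: exec_in_eq (IHb _ _ _ _ (sc' _ _) _ r0 rr _).
  + rewrite !map_upd // -/B => i; rewrite /upd eqxx; case: (i =P r) => [->|//].
    have -> : (r == d) = false by lia.
    have -> : A - k = (A - k.+1).+1 by lia.
    by rewrite mulSn; lia.
  + exact: ltnW.
  + by rewrite !map_upd.
- have [_ _ sd _] := sc; have sd0 := sd d (leqnn d); have sd1 := sd d.+1 (leqnSn d).
  have dr := scratch_notin sc (leqnn d); have dr1 := scratch_notin sc (leqnSn d).
  set A := eval _ a; set B := eval _ b.
  have AN : A <= val_bound a N by apply: eval_bound.
  have BN : B <= val_bound b N by apply: eval_bound.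
  apply: exec_in_seq (IHa _ _ _ _ (scratch_weak sc) (ltnSn d) _ dr sN) _.
    by case: sc.
  rewrite -/A; apply: exec_in_seq (IHb _ _ _ _ _ (ltnSn d.+1) _ dr1 _) _ => //.
  + exact/scratch_weak/scratch_next.
  + by rewrite map_upd.
  rewrite map_upd // -/B.
  (* Decrementing stops at 0, which yields truncated subtraction; the second loop moves the
     difference to [r]. *)
  pose S1 k := (upd (upd s d (A - (B - k))) d.+1 k, o).
  pose S2 k := (upd (upd s d k) r (s r + ((A - B) - k)), o).
  have e1 : (upd (upd s d (s d + A)) d.+1 (upd s d (s d + A) d.+1 + B), o) = S1 B.
    by congr pair; apply: functional_extensionality; rewrite /= subnn subn0; regs_eq.
  have e2 : S1 0 = S2 (A - B).
    by congr pair; apply: functional_extensionality; rewrite /= subnn subn0; regs_eq.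
  have e3 : S2 0 = (upd s r (s r + (A - B)), o).
    by congr pair; apply: functional_extensionality; rewrite subn0; regs_eq.
  rewrite e1 -e3.
  apply: exec_in_le (exec_in_seq (exec_in_while (S := S1) (T := 2) _ _) _); last first.
  + rewrite e2; apply: (exec_in_while (S := S2) (T := 2)).
      by rewrite /= /upd eqxx; case: eqP => //; lia.
    move=> k kn; split; first by rewrite /= /upd eqxx (_ : (d == r) = false) //; lia.
    apply: exec_in_eq (exec_in_seq (exec_in_dec _ _ _ _) (exec_in_inc _ _ _ _)).
    by regs_eq.
  + move=> k kn; split; first by rewrite /= /upd eqxx.
    apply: exec_in_eq (exec_in_seq (exec_in_dec _ _ _ _) (exec_in_dec _ _ _ _)).
    by regs_eq.
  + by rewrite /= /upd eqxx.
  + by lia.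
- have [d0 s0 sd _] := sc; have sd0 := sd d (leqnn d); have sd1 := sd d.+1 (leqnSn d).
  have dr := scratch_notin sc (leqnn d).
  set A := eval _ a.
  have AN : A <= val_bound a N by apply: eval_bound.
  apply: exec_in_seq (IHa _ _ _ _ (scratch_weak sc) (ltnSn d) d0 dr sN) _; rewrite -/A.
  (* The cursor is moved to [A], with a copy of [A] in [d.+1] that later leads it back to 0. One
     more increment is needed before the test since the cursor counts from 1. *)
  pose S1 k := (upd (upd (upd s d k) 0 (A - k)) d.+1 (A - k), o).
  set v := nat_of_bool _.
  pose S2 k := (upd (upd (upd s r (s r + v)) 0 k) d.+1 k, o).
  have e1 : (upd s d (s d + A), o) = S1 A.
    by congr pair; apply: functional_extensionality; rewrite /= subnn; regs_eq.
  have e2 : S2 0 = (upd s r (s r + v), o).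
    by congr pair; apply: functional_extensionality; regs_eq.
  rewrite e1 -e2.
  apply: (@exec_in_le _ _ _ (A * 5 + 1 + (1 + (3 + (1 + (A * 4 + 1)))))); first by lia.
  apply: exec_in_seq (exec_in_while (S := S1) (T := 3) _ _) _.
  + by rewrite /= /upd /=; do ?[case: eqP => ? //]; lia.
  + move=> k kn; split; first by rewrite /= /upd /=; do ?case: eqP => //; lia.
    apply: exec_in_eq (exec_in_seq (exec_in_dec _ _ _ _)
      (exec_in_seq (exec_in_inc _ _ _ _) (exec_in_inc _ _ _ _))).
    by regs_eq.
  apply: exec_in_seq (exec_in_inc _ _ _ _) _.
  pose s2 := upd (upd s 0 A.+1) d.+1 A.
  have -> : (upd (S1 0).1 0 ((S1 0).1 0).+1) = s2.
    by apply: functional_extensionality; rewrite /S1 /s2 /= !subn0; regs_eq.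
  apply: (exec_in_seq (s2 := (upd s2 r (s2 r + v), o))).
    apply: (@exec_in_if y IsBit _ _ (s2, o) _ 1).
    have -> : holds y s2 IsBit = nth false y A by rewrite /= /s2 /upd.
    rewrite /v -/A; case: nth.
      by apply: exec_in_eq (exec_in_inc _ _ _ _); regs_eq.
    by apply: exec_in_eq (exec_in_skip _ _ _); regs_eq.
  apply: (exec_in_seq (s2 := S2 A)).
    by apply: exec_in_eq (exec_in_dec _ _ _ _); rewrite /s2; regs_eq.
  apply: (exec_in_while (S := S2) (T := 2)).
    by rewrite /= /upd eqxx.
  move=> k kn; split; first by rewrite /= /upd eqxx.
  apply: exec_in_eq (exec_in_seq (exec_in_dec _ _ _ _) (exec_in_dec _ _ _ _)).
  by regs_eq.
Qed.
End Expr.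

(** * Nested loops *)

Lemma bin_rec_fuel f g n : n <= f -> n <= g -> bin_rec f n = bin_rec g n.
Proof.
elim: f g n => [|f IH] [|g] [|n] //= nf ng; congr cons.
by apply: IH; rewrite uphalf_half; lia.
Qed.

(** The recurrence followed by [emit_digits]; it holds because sufficient fuel has no influence on
    the digits. *)
Lemma binE n : 0 < n -> bin n = odd n :: bin n./2.
Proof.
case: n => // n _; rewrite /bin /=; congr cons.
by apply: bin_rec_fuel; rewrite ?uphalf_half; lia.
Qed.

Lemma delimit_cons b x : delimit (b :: x) = [:: true, b & delimit x].
Proof. by []. Qed.

Lemma size_delimit x : size (delimit x) = size x + size x + 1.
Proof. by elim: x => // b x IH; rewrite delimit_cons /= IH; lia. Qed.

Inductive gen :=
| Lit of seq bool
| Cat of gen & gen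
| For of expr & gen
| Cond of expr & gen & gen
| Bin of expr.

Section Gen.
Variable y : seq bool.

Fixpoint gen_eval (env : seq nat) (g : gen) : seq bool :=
  match g with
  | Lit w => w
  | Cat g1 g2 => gen_eval env g1 ++ gen_eval env g2
  | For e g => flatten [seq gen_eval (u :: env) g | u <- iota 0 (eval y env e)]
  | Cond e g1 g2 => if eval y env e != 0 then gen_eval env g1 else gen_eval env g2
  | Bin e => delimit (bin (eval y env e))
  end.

(** Two units of [d] make one unit of [d.+1]; a unit left over goes to [d.+2], which thereby
    receives the parity. *)
Definition halve (d : nat) : cmd :=
  While d (Seq (Dec d) (If (IsZero d) (Inc d.+2) (Seq (Dec d) (Inc d.+1)))).

(** Repeated halving gives the least significant digit first, as in [bin]; every digit is preceded
    by the [true] of [delimit], whose closing [false] is left to the caller. *)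
Definition emit_digits (d : nat) : cmd :=
  While d (Seq (halve d)
     (Seq (Emit true)
     (Seq (If (IsZero d.+2) (Emit false) (Seq (Emit true) (Dec d.+2)))
          (While d.+1 (Seq (Dec d.+1) (Inc d)))))).

(** In a loop, [d] counts the remaining rounds down while [d.+1] counts up and serves as the loop
    variable, the new variable 0. *)
Fixpoint gen_cmd (g : gen) (rho : seq nat) (d : nat) : cmd :=
  match g with
  | Lit w => foldr (fun b => Seq (Emit b)) Skip w
  | Cat g1 g2 => Seq (gen_cmd g1 rho d) (gen_cmd g2 rho d)
  | For e g =>
      Seq (add_to e rho d.+1 d)
     (Seq (While d (Seq (Dec d) (Seq (gen_cmd g (d.+1 :: rho) d.+2) (Inc d.+1))))
          (While d.+1 (Dec d.+1)))
  | Cond e g1 g2 =>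
      Seq (add_to e rho d.+1 d)
          (If (IsZero d) (gen_cmd g2 rho d)
             (Seq (While d (Dec d)) (gen_cmd g1 rho d)))
  | Bin e => Seq (add_to e rho d.+1 d) (Seq (emit_digits d) (Emit false))
  end.

Fixpoint gen_time (g : gen) (N : nat) : nat :=
  match g with
  | Lit w => size w
  | Cat g1 g2 => gen_time g1 N + gen_time g2 N
  | For e g => time_bound e N +
      (val_bound e N * (gen_time g (N + val_bound e N) + 4) + 1 + (val_bound e N * 3 + 1))
  | Cond e g1 g2 => time_bound e N +
      (val_bound e N * 3 + 3 + (gen_time g1 N + gen_time g2 N))
  | Bin e => time_bound e N + (val_bound e N * (val_bound e N * 10 + 10) + 2)
  end.

Definition regs3 (s : regs) (d a b c : nat) : regs :=
  upd (upd (upd s d a) d.+1 b) d.+2 c.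

Lemma regs3_0 s d a b c : regs3 s d a b c d = a.
Proof. by rewrite /regs3 /upd eqxx; do ?[case: eqP => ? //]; lia. Qed.

Lemma regs3_1 s d a b c : regs3 s d a b c d.+1 = b.
Proof. by rewrite /regs3 /upd eqxx; do ?[case: eqP => ? //]; lia. Qed.

Lemma halve_correct s o d n a :
  exec_in y (halve d) (regs3 s d n a 0, o) (n * 6 + 1) (regs3 s d 0 (a + n./2) (odd n), o).
Proof.
elim/ltn_ind: n a => -[|[|n]] IH a.
- by rewrite addn0; apply: exec_in_while0; rewrite //= ?regs3_0 ?regs3_1.
- rewrite addn0; apply: exec_in_le (exec_in_whileS _ (s2 := (regs3 s d 0 a 1, o)) (T1 := 4) _
    (@exec_in_while0 _ _ _ _ 1 _ _)) => //.
  + by rewrite /= ?regs3_0 ?regs3_1.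
  + apply: exec_in_seq (exec_in_dec _ _ _ _) _; apply: (exec_in_if (T := 1)).
    rewrite /=; case: ifP; last by rewrite /upd eqxx ?regs3_0 ?regs3_1.
    by move=> _; apply: exec_in_eq (exec_in_inc _ _ _ _); rewrite /regs3; regs_eq.
  + by rewrite /= ?regs3_0 ?regs3_1.
- rewrite [odd _]/= negbK (_ : a + n.+2./2 = a.+1 + n./2); last by rewrite /= addnS.
  apply: exec_in_le (exec_in_whileS _ (s2 := (regs3 s d n a.+1 0, o)) (T1 := 5) _
    (IH n _ _)); first by lia.
  + by rewrite /= ?regs3_0 ?regs3_1.
  + apply: exec_in_seq (exec_in_dec _ _ _ _) _; apply: (exec_in_if (T := 2)).
    rewrite /=; case: ifP; first by rewrite /upd eqxx ?regs3_0 ?regs3_1.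
    move=> _; apply: exec_in_eq (exec_in_seq (exec_in_dec _ _ _ _) (exec_in_inc _ _ _ _)).
    by rewrite /regs3; regs_eq.
  + by lia.
Qed.

(** Each round replaces the number by its smaller half, so there are at most [n] rounds. A bound
    quadratic in the value is enough, as all printed values are polynomial in the input length. *)
Lemma emit_digits_correct s o d n N : n <= N ->
  exec_in y (emit_digits d) (regs3 s d n 0 0, o) (n * (N * 10 + 10) + 1)
    (regs3 s d 0 0 0, o ++ flatten [seq [:: true; b] | b <- bin n]).
Proof.
elim/ltn_ind: n o => -[|n] IH o nN.
  rewrite cats0; apply: exec_in_while0; rewrite //.
  by rewrite /= ?regs3_0 ?regs3_1.
rewrite binE //; set m := n.+1./2.
have mn : m < n.+1 by rewrite /m; lia.
apply: exec_in_le (exec_in_whileS _ (s2 := (regs3 s d m 0 0, o ++ [:: true; odd n.+1]))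
   (T1 := N * 10 + 8) _ _); last 3 first.
- by rewrite /= ?regs3_0 ?regs3_1.
- apply: (@exec_in_le _ _ _ (n.+1 * 6 + 1 + (1 + (2 + 2 + (m * 4 + 1))))); first by lia.
  apply: exec_in_seq (halve_correct _ _ _ _ _) _.
  apply: exec_in_seq (exec_in_emit _ _ _ _) _; rewrite add0n -/m.
  apply: (exec_in_seq (s2 := (regs3 s d 0 m 0, o ++ [:: true; odd n.+1]))).
    apply: exec_in_if.
    have hb (b : bool) : holds y (regs3 s d 0 m b) (IsZero d.+2) = ~~ b.
      by rewrite /= /regs3 /upd eqxx; case: b.
    rewrite hb.
    rewrite -cat_rcons cats1; case: (odd n.+1).
      apply: exec_in_eq (exec_in_seq (exec_in_emit _ _ _ _) (exec_in_dec _ _ _ _)).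
      by rewrite /regs3; regs_eq.
    exact: exec_in_le (exec_in_emit _ _ _ _).
  pose S k := (regs3 s d (m - k) k 0, o ++ [:: true; odd n.+1]).
  have -> : (regs3 s d 0 m 0, o ++ [:: true; odd n.+1]) = S m by rewrite /S subnn.
  have -> : (regs3 s d m 0 0, o ++ [:: true; odd n.+1]) = S 0 by rewrite /S subn0.
  apply: (exec_in_while (S := S) (T := 2)).
    by rewrite /= ?regs3_0 ?regs3_1.
  move=> k kn; split; first by rewrite /= ?regs3_0 ?regs3_1.
  apply: exec_in_eq (exec_in_seq (exec_in_dec _ _ _ _) (exec_in_inc _ _ _ _)).
  by rewrite /regs3; regs_eq.
- rewrite (_ : o ++ flatten _ = (o ++ [:: true; odd n.+1]) ++
             flatten [seq [:: true; b] | b <- bin m]); last by rewrite -catA.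
  by apply: IH => //; lia.
- have : m * (N * 10 + 10) <= n * (N * 10 + 10) by rewrite leq_mul2r; lia.
  by rewrite mulSn; lia.
Qed.

Lemma gen_cmd_correct g rho d s o N : scratch s rho d -> all (geq N) (map s rho) ->
  exec_in y (gen_cmd g rho d) (s, o) (gen_time g N) (s, o ++ gen_eval (map s rho) g).
Proof.
elim: g rho d s o N => [w|g1 IH1 g2 IH2|e g IH|e g1 IH1 g2 IH2|e] rho d s o N sc sN /=.
- elim: w o => [|b w IH] o /=; first by rewrite cats0; apply: exec_in_skip.
  by apply: exec_in_seq (exec_in_emit _ _ _ _) _; rewrite -cat_rcons; apply: IH.
- by rewrite catA; apply: exec_in_seq (IH1 _ _ _ _ _ sc sN) (IH2 _ _ _ _ _ sc sN).
- have [d0 s0 sd rd] := sc; have sd0 := sd d (leqnn d); have sd1 := sd d.+1 (leqnSn d).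
  have dr := scratch_notin sc (leqnn d); have dr1 := scratch_notin sc (leqnSn d).
  set n := eval _ _ e; have nN : n <= val_bound e N by apply: eval_bound.
  apply: exec_in_seq (add_to_correct _ _ _ (scratch_weak sc) (ltnSn d) d0 dr sN) _.
  rewrite -/n; set G := fun u => gen_eval (u :: map s rho) g.
  (* With [k] rounds to go, the rounds for loop values below [n - k] have been printed. *)
  pose S k := (upd (upd s d k) d.+1 (n - k), o ++ flatten [seq G u | u <- iota 0 (n - k)]).
  have -> : (upd s d (s d + n), o) = S n.
    congr pair; last by rewrite subnn cats0.
    by apply: functional_extensionality; rewrite /= subnn; regs_eq.
  apply: exec_in_le (exec_in_seq (exec_in_while (S := S)
    (T := 1 + (gen_time g (N + val_bound e N) + 1)) _ _) _); last first.
  + rewrite /S subn0; apply: exec_in_eq (exec_in_clear (n := n) _ _ _).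
      by regs_eq.
    by rewrite /upd eqxx.
  + move=> k kn; split.
      by rewrite /= /upd eqxx; rewrite (_ : (d == d.+1) = false) //; lia.
    apply: exec_in_seq (exec_in_dec _ _ _ _) _.
    set s1 := upd _ d _; have s1E : s1 = upd (upd s d k) d.+1 (n - k.+1).
      by apply: functional_extensionality; rewrite /s1; regs_eq.
    rewrite {}s1E {s1}; set s1 := upd _ _ _.
    have s1r : map s1 (d.+1 :: rho) = (n - k.+1) :: map s rho.
      by rewrite /= !map_upd // {1}/s1 /upd eqxx.
    apply: exec_in_seq (IH (d.+1 :: rho) _ _ _ (N + val_bound e N) _ _) _.
    * split=> //; first by rewrite /s1 /upd /=; case: eqP => //; lia.
        by move=> i di; rewrite /s1 /upd; do ?[case: eqP => ? //]; try lia; apply: sd; lia.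
      by move=> v; rewrite inE => /predU1P[->|/rd]; lia.
    * rewrite s1r /=; apply/andP; split; first by lia.
      by apply/allP => v /(allP sN) /=; lia.
    rewrite s1r -/(G _).
    have -> : S k = (upd s1 d.+1 (s1 d.+1).+1, (o ++ flatten [seq G u | u <- iota 0 (n - k.+1)])
       ++ G (n - k.+1)).
      rewrite /S; have -> : n - k = (n - k.+1).+1 by lia.
      have -> m : iota 0 m.+1 = iota 0 m ++ [:: m] by rewrite -addn1 iotaD.
      rewrite map_cat flatten_cat /= cats0 catA; congr pair.
      by apply: functional_extensionality; rewrite /s1; regs_eq.
    exact: exec_in_inc.
  + by rewrite /= /upd eqxx; case: eqP => //; lia.
  + have : n * (gen_time g (N + val_bound e N) + 4) <=
           val_bound e N * (gen_time g (N + val_bound e N) + 4) by rewrite leq_mul2r nN orbT.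
    have -> : 1 + (gen_time g (N + val_bound e N) + 1) + 2 =
              gen_time g (N + val_bound e N) + 4 by lia.
    by lia.
- have [d0 s0 sd rd] := sc; have sd0 := sd d (leqnn d).
  have dr := scratch_notin sc (leqnn d).
  set n := eval _ _ e; have nN : n <= val_bound e N by apply: eval_bound.
  apply: exec_in_seq (add_to_correct _ _ _ (scratch_weak sc) (ltnSn d) d0 dr sN) _.
  rewrite -/n.
  apply: (@exec_in_le _ _ _ (val_bound e N * 3 + 1 + (gen_time g1 N + gen_time g2 N) + 2)).
    by lia.
  apply: exec_in_if.
  have -> : holds y (upd s d (s d + n)) (IsZero d) = (n == 0) by rewrite /= /upd eqxx sd0.
  case: eqP => [n0|nz] /=.
    have -> : upd s d (s d + n) = s by apply: functional_extensionality; regs_eq.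
    by apply: exec_in_le (IH2 _ _ _ _ _ sc sN); lia.
  apply: (@exec_in_le _ _ _ (val_bound e N * 3 + 1 + gen_time g1 N)); first by lia.
  apply: (exec_in_seq (s2 := (s, o))); last exact: IH1.
  apply: exec_in_eq (exec_in_clear _ _ _); first by regs_eq.
  by rewrite /upd eqxx sd0.
- have [d0 s0 sd rd] := sc; have sd0 := sd d (leqnn d).
  have sd1 := sd d.+1 (leqnSn d); have sd2 : s d.+2 = 0 by apply: sd; lia.
  have dr := scratch_notin sc (leqnn d).
  set n := eval _ _ e; have nN : n <= val_bound e N by apply: eval_bound.
  apply: exec_in_seq (add_to_correct _ _ _ (scratch_weak sc) (ltnSn d) d0 dr sN) _.
  rewrite -/n /delimit catA cats1.
  have -> : upd s d (s d + n) = regs3 s d n 0 0.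
    by apply: functional_extensionality; rewrite /regs3; regs_eq.
  have e0 : regs3 s d 0 0 0 = s.
    by apply: functional_extensionality; rewrite /regs3; regs_eq.
  apply: (@exec_in_le _ _ _ (n * (val_bound e N * 10 + 10) + 1 + 1)).
    have : n * (val_bound e N * 10 + 10) <= val_bound e N * (val_bound e N * 10 + 10).
      by rewrite leq_mul2r nN orbT.
    by lia.
  apply: exec_in_seq (emit_digits_correct _ _ _ nN) _.
  by rewrite e0; apply: exec_in_emit.
Qed.

End Gen.

(** * Polynomial running time of nested loops *)

Lemma val_bound_poly e : poly_bounded (val_bound e).
Proof.
elim: e => [i|c|a IHa b IHb|a IHa b IHb|a IHa b IHb|a IHa] /=.
- exact: poly_bounded_id.
- exact: poly_bounded_const.
- exact: poly_boundedD.
- exact: poly_boundedM.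
- exact: IHa.
- exact: poly_bounded_const.
Qed.

Ltac poly_bound_tac := repeat first
  [ exact: poly_bounded_const | exact: poly_bounded_id | exact: val_bound_poly
  | assumption | apply: poly_boundedD | apply: poly_boundedM ].

Lemma time_bound_poly e : poly_bounded (time_bound e).
Proof. by elim: e => /= *; poly_bound_tac. Qed.

Lemma gen_time_poly g : poly_bounded (gen_time g).
Proof.
elim: g => [w|g1 IH1 g2 IH2|e g IH|e g1 IH1 g2 IH2|e] /=; poly_bound_tac;
  try exact: time_bound_poly.
(* The loop variable enlarges the bound on the environment of the body, hence a composition. *)
by apply: poly_bounded_comp IH _; poly_bound_tac.
Qed.

(** The cursor is first cleared, as [scratch] requires; register 1 already contains the input
    length, the only variable. *)
Theorem gen_polytime (g : gen) :
  polytime (fun x => gen_eval (delimit x) [:: size x] g).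
Proof.
pose c := Seq (While 0 (Dec 0)) (gen_cmd g [:: 1] 2).
apply: (@cmd_polytime c _ (fun n => ((n + n + 2) * 3 + 1) + gen_time g n)).
  by poly_bound_tac; apply: gen_time_poly.
move=> x; set s := upd (init_regs x) 0 0.
have cl : exec_in (delimit x) (While 0 (Dec 0)) (init_regs x, [::])
    ((size x + size x + 2) * 3 + 1) (s, [::]).
  by apply: exec_in_clear; rewrite /= size_delimit; lia.
have [||t le ex] := exec_in_seq cl
    (@gen_cmd_correct (delimit x) g [:: 1] 2 s [::] (size x) _ _).
- split=> //; last by move=> v; rewrite inE => /eqP ->.
  by case=> [|[|i]].
- by rewrite /= leqnn.
by exists t => //; exists s.
Qed.

(** * Cliques as schedules *)

(** Distinct naturals sum to at least 0 + 1 + 2 + ...: by pigeonhole one of [n.+1] distinct values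
    is at least [n], and it is removed. *)
Lemma sum_injective (T : finType) (D : {set T}) (f : T -> nat) :
  {in D &, injective f} -> 'C(#|D|, 2) <= \sum_(j in D) f j.
Proof.
move: {2}#|D| (erefl #|D|) => n; elim: n D => [|n IH] D cD fi; first by rewrite cD.
have [j jD fj] : exists2 j, j \in D & n <= f j.
  apply/exists_inP; apply: contraT; rewrite negb_exists_in => /forall_inP small.
  suff : size [seq f j | j <- enum D] <= size (iota 0 n).
    by rewrite size_map size_iota -cardE cD ltnn.
  apply: uniq_leq_size.
    by rewrite map_inj_in_uniq ?enum_uniq // => a b; rewrite !mem_enum; apply: fi.
  by move=> _ /mapP[j + ->]; rewrite mem_enum mem_iota => /small; lia.
rewrite cD (big_setD1 j) //= binS bin1 addnC.
have cD' : #|D :\ j| = n by have := cardsD1 j D; rewrite jD cD; lia.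
apply: leq_add => //; rewrite -cD'; apply: IH => //.
by move=> a b /setD1P[_ aD] /setD1P[_ bD]; apply: fi.
Qed.

Lemma bin2D a b : 'C(a + b, 2) = 'C(a, 2) + 'C(b, 2) + a * b.
Proof.
elim: a => [|a IH]; first by rewrite bin0n mul0n !add0n addn0.
by rewrite addSn !binS !bin1 IH mulSn; lia.
Qed.

Lemma sum_injective_gap (T : finType) (f : T -> nat) (t : nat) : injective f ->
  let X := [set j | f j < t] in
  #|X| <= t -> 'C(#|T|, 2) + #|~: X| * (t - #|X|) <= \sum_j f j.
Proof.
move=> fi X Xt.
have h1 : 'C(#|X|, 2) <= \sum_(j in X) f j by apply: sum_injective => a b _ _ /fi.
have h2 : 'C(#|~: X|, 2) <= \sum_(j in ~: X) (f j - t).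
  apply: sum_injective => a b; rewrite !inE -!leqNgt => la lb e; apply: fi; lia.
have h3 : \sum_(j in ~: X) f j = \sum_(j in ~: X) (f j - t) + #|~: X| * t.
  rewrite -sum_nat_const -big_split /=; apply: eq_bigr => j.
  by rewrite !inE -leqNgt => le; rewrite subnK.
have -> : \sum_j f j = \sum_(j in X) f j + \sum_(j in ~: X) f j.
  by rewrite (bigID (mem X)) /=; congr (_ + _); apply: eq_bigl => j; rewrite !inE.
have := cardsC X; set a := #|X| in h1 Xt *; set b := #|~: X| in h2 h3 * => ab.
rewrite h3 -ab bin2D mulnBr (mulnC a b).
have : b * a <= b * t by rewrite leq_mul2l Xt orbT.
by lia.
Qed.

Section CliqueJrp.
Variables (U : finType) (compat : rel U) (k : nat) (u0 : U).

(* [late_jobs] only has to exceed [k]; this value makes the number of jobs even. *)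
Definition half_jobs := #|U| * #|U| + k + 1.
Definition late_jobs := half_jobs + k + 1.
(** Ordered pairs with the diagonal, so that [k] elements span exactly [k * k] pair jobs. *)
Definition job := (U * U + 'I_late_jobs)%type.

Definition job_req (j : job) : {set U} :=
  if j is inl p then if compat p.1 p.2 then [set p.1; p.2] else setT else setT.

Definition job_release (j : job) : nat := if j is inl _ then 0 else k * k.

Definition clique_proc : {ffun 'I_#|{: job}| -> nat} := [ffun=> 1].
Definition clique_release : {ffun 'I_#|{: job}| -> nat} :=
  [ffun j => job_release (enum_val j)].
Definition clique_req : {ffun 'I_#|{: job}| -> {set 'I_#|U|}} :=
  [ffun j => [set i | enum_val i \in job_req (enum_val j)]].

Lemma clique_proc_gt0 : [forall j, 0 < clique_proc j].
Proof. by apply/forallP => j; rewrite ffunE. Qed.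

Lemma job_req_neq0 j : exists u, u \in job_req j.
Proof.
case: j => [[a b]|l] /=; last by exists u0; rewrite inE.
by exists a; case: ifP; rewrite !inE ?eqxx.
Qed.

Lemma clique_req_neq0 : [forall j, clique_req j != set0].
Proof.
apply/forallP => j; rewrite ffunE; have [u uj] := job_req_neq0 (enum_val j).
by apply/set0Pn; exists (enum_rank u); rewrite inE enum_rankK.
Qed.

Definition clique_jrp : jrp :=
  @Jrp #|{: job}| #|U| clique_proc clique_release clique_req 0 [ffun=> 1]
    clique_proc_gt0 clique_req_neq0.

(** With n jobs the product is n (n + 1) / 2, the sum of completion times without idle time; it is
    written without division as n is even. The rest pays for [k] early resources and one full
    replenishment. *)
Definition clique_threshold : nat := half_jobs * (half_jobs.*2 + 1) + k + #|U|.

Lemma card_job : #|{: job}| = half_jobs.*2.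
Proof. by rewrite card_sum card_prod card_ord /late_jobs -addnn /half_jobs; lia. Qed.

Lemma clique_thresholdE : clique_threshold = 'C(#|{: job}|, 2) + #|{: job}| + k + #|U|.
Proof.
rewrite /clique_threshold card_job; congr (_ + _ + _).
by rewrite -addnn bin2D; elim: half_jobs => // h; rewrite binS bin1; nia.
Qed.

Hypotheses (k0 : 0 < k) (kU : k < #|U|).

(** * From a cheap schedule to a clique *)

Section Lower.
Variables (R : archiRealDomainType) (s : solution R clique_jrp).
Hypothesis fs : feasible s.
Local Open Scope ring_scope.

Let T := (k * k)%N.

Definition early : {set 'I_#|U|} := \bigcup_(q <- repl s | q.2 < T%:R) q.1.

(** A job requires at least one resource, so some replenishment lies between its release and its
    start. *)
Lemma readyP j : exists2 q, q \in repl s & (clique_release j)%:R <= q.2 <= start s j.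
Proof.
have /forallP/(_ j)/set0Pn[i ij] := clique_req_neq0.
have /subsetP/(_ _ ij) := fs.2 j.
have : forall r : seq ({set 'I_#|U|} * R),
   i \in \bigcup_(q <- r | (release clique_jrp j)%:R <= q.2 <= start s j) q.1 ->
   exists2 q, q \in r & (clique_release j)%:R <= q.2 <= start s j.
  elim=> [|q r IH]; first by rewrite big_nil inE.
  rewrite big_cons; case: ifP => [h _|_ /IH[q' q'r h]]; first by exists q; rewrite ?mem_head.
  by exists q' => //; rewrite inE q'r orbT.
by move=> h /h.
Qed.

Lemma start_ge_release j : (clique_release j)%:R <= start s j.
Proof. by have [q _ /andP[]] := readyP j; apply: le_trans. Qed.

Lemma start_ge0 j : 0 <= start s j.
Proof. by apply: le_trans (start_ge_release j); rewrite ler0n. Qed.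

(** Start times may be fractional; rounding down keeps unit jobs distinct and does not raise the
    cost, which reduces the argument to natural numbers. *)
Definition slot j : nat := Num.truncn (start s j).

Lemma slot_inj : injective slot.
Proof.
suff lt_slot i j : start s i + 1 <= start s j -> (slot i < slot j)%N.
  move=> i j e; apply/eqP; apply: contraT => ij.
  have [] := fs.1 _ _ ij; rewrite /completion !ffunE => /lt_slot; rewrite e; by rewrite ltnn.
move=> le; rewrite /slot truncn_gt_nat; apply: le_trans le.
by rewrite -natr1 lerD2r truncn_le start_ge0.
Qed.

Lemma cost_lower :
  ((\sum_j (slot j).+1 + \sum_(q <- repl s) #|q.1|)%N%:R : R) <= total_cost s.
Proof.
rewrite natrD; apply: lerD.
  rewrite natr_sum; apply: ler_sum => j _; rewrite /completion ffunE -natr1 lerD2r.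
  by rewrite truncn_le start_ge0.
rewrite natr_sum /repl_cost; apply: ler_sum => q _; rewrite ler_nat /=.
by under eq_bigr do rewrite ffunE; rewrite sum1_card.
Qed.

Lemma card_bigcup_seq (I : Type) (V : finType) (r : seq I) (P : pred I) (F : I -> {set V}) :
  (#|\bigcup_(q <- r | P q) F q| <= \sum_(q <- r | P q) #|F q|)%N.
Proof.
elim/big_rec2: _ => [|q n A _ le]; first by rewrite cards0.
apply: leq_trans (leq_add (leqnn _) le); rewrite cardsU; exact: leq_subr.
Qed.

(** A late job needs every resource replenished at time [T] or later; this comes on top of the early
    replenishments. *)
Lemma repl_lower : (#|early| + #|U| <= \sum_(q <- repl s) #|q.1|)%N.
Proof.
rewrite (bigID (fun q : {set 'I_#|U|} * R => q.2 < T%:R)) /=.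
apply: leq_add; first exact: card_bigcup_seq.
have L0 : (0 < late_jobs)%N by rewrite /late_jobs; lia.
pose j : 'I_#|{: job}| := enum_rank (inr (Ordinal L0) : job).
have := fs.2 j; rewrite /ready /= !ffunE enum_rankK /= => /subset_leq_card.
rewrite (_ : [set i | _] = setT) ?cardsT ?card_ord; last by apply/setP => i; rewrite !inE.
move=> le; apply: leq_trans le _; apply: leq_trans (card_bigcup_seq _ _ _) _.
rewrite [X in (X <= _)%N]big_mkcond [X in (_ <= X)%N]big_mkcond /=.
apply: leq_sum => q _; rewrite -leNgt -/T.
by case: (T%:R <= q.2) => //=; case: ifP.
Qed.

(** A job started before [T] cannot be late, and all replenishments that make it ready occur before
    [T]. *)
Lemma early_req j : (slot j < T)%N ->
  exists2 p, enum_val j = inl p & forall u, u \in job_req (inl p) -> enum_rank u \in early.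
Proof.
rewrite /slot truncn_lt_nat ?start_ge0 // => lt_j.
case E: (enum_val j) => [p|l]; last first.
  have := start_ge_release j; rewrite ffunE E /= => /le_lt_trans/(_ lt_j).
  by rewrite ltxx.
exists p => // u up; have := fs.2 j; rewrite /ready /= => /subsetP/(_ (enum_rank u)).
rewrite ffunE inE enum_rankK E up => /(_ isT).
rewrite /early; elim: (repl s) => [|q r IH]; first by rewrite !big_nil.
rewrite !big_cons; case: ifP => [/andP[_ le]|_ /IH h].
  by rewrite (le_lt_trans le lt_j) !inE => /orP[->//|/IH ->]; rewrite orbT.
by case: ifP => // _; rewrite inE h orbT.
Qed.

Lemma clique_of_solution : total_cost s <= (clique_threshold%:R : R) ->
  exists A : {set U}, #|A| = k /\ {in A &, forall a b, compat a b}.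
Proof.
move=> /(le_trans cost_lower); rewrite ler_nat clique_thresholdE => cost.
have rl := repl_lower.
have sumS : (\sum_j (slot j).+1 = \sum_j slot j + #|{: job}|)%N.
  by under eq_bigr do rewrite -addn1; rewrite big_split /= sum1_card card_ord.
pose X := [set j | (slot j < T)%N].
have binle : ('C(#|{: job}|, 2) <= \sum_j slot j)%N.
  have := @sum_injective _ setT slot; rewrite cardsT card_ord.
  by move=> /(_ (in2W slot_inj)); rewrite (eq_bigl xpredT) // => j; rewrite inE.
(* Slots and the full replenishment already use up the threshold except for [k]. *)
have eA : (#|early| <= k)%N by rewrite sumS in cost; lia.
pose A := [set u : U | enum_rank u \in early].
have cA : #|A| = #|early|.
  rewrite -(card_imset (mem early) (@enum_val_inj _ _)); apply: eq_card => u.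
  rewrite inE; apply/idP/imsetP => [uE|[i iE ->]]; last by rewrite enum_valK.
  by exists (enum_rank u); rewrite ?enum_rankK.
pose Y := [set p : U * U | enum_rank (inl p : job) \in X].
have cY : #|Y| = #|X|.
  have Xinl j : j \in X -> exists2 p, j = enum_rank (inl p : job) & p \in Y.
    rewrite inE => jX; have [p e _] := early_req jX.
    by exists p; rewrite ?inE -e enum_valK.
  have inj : injective (fun p : U * U => enum_rank (inl p : job)).
    by move=> p q /enum_rank_inj [].
  rewrite -(card_imset (mem Y) inj); apply: eq_card => j; apply/imsetP/idP.
    by move=> [p pY ->]; move: pY; rewrite !inE.
  by move=> /Xinl[p -> pY]; exists p.
(* An incompatible pair would require all of [U] early, which is more than [k] resources. *)
have YA p : p \in Y -> [/\ p.1 \in A, p.2 \in A & compat p.1 p.2].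
  rewrite !inE => /early_req[q]; rewrite enum_rankK => -[<-] h.
  have cp : compat p.1 p.2.
    apply: contraT => ncp; have : (#|U| <= #|early|)%N.
      rewrite -cA -cardsT; apply/subset_leq_card/subsetP => u _; rewrite inE.
      by apply: h; rewrite /= (negPf ncp) inE.
    by lia.
  by rewrite cp; split=> //; apply: h; rewrite /= cp !inE eqxx ?orbT.
have YsA : Y \subset setX A A.
  by apply/subsetP => -[a b] /YA[/= aA bA _]; rewrite inE /= aA bA.
(* Otherwise an idle slot before [T] delays all jobs outside [X], of which there are more than [k],
   by at least one each, beyond the slack [k]. *)
have XT : (T <= #|X|)%N.
  rewrite leqNgt; apply/negP => lt.
  have : ('C(#|{: job}|, 2) + #|~: X| * (T - #|X|) <= \sum_j slot j)%N.
    by have := @sum_injective_gap _ slot T slot_inj (ltnW lt); rewrite card_ord.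
  have cX := cardsC X.
  have cXU : (#|X| <= #|U| * #|U|)%N by rewrite -cY -card_prod max_card.
  have : (1 <= T - #|X|)%N by lia.
  have : (k < #|~: X|)%N.
    have {}cX : (#|X| + #|~: X| = half_jobs.*2)%N by rewrite cX card_ord -card_job.
    by rewrite /half_jobs -addnn in cX; lia.
  move: (T - #|X|)%N #|~: X| => a b kb a0 gap.
  have : (b <= b * a)%N by rewrite leq_pmulr.
  by rewrite sumS in cost; lia.
(* Now [k * k] pairs lie in the square of a set of at most [k] elements, so they fill it. *)
have le1 := subset_leq_card YsA; rewrite cardsX cY cA in le1.
have Ak : #|early| = k.
  apply/eqP; rewrite eqn_leq eA leqNgt; apply/negP => lt.
  have : (#|early| * #|early| < k * k)%N by apply: ltn_mul.
  by rewrite -/T; lia.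
have YE : Y = setX A A.
  by apply/eqP; rewrite eqEcard YsA cardsX cA cY Ak.
exists A; split; first by rewrite cA.
by move=> a b aA bA; have /YA[] : (a, b) \in Y by rewrite YE inE /= aA bA.
Qed.

End Lower.

(** * From a clique to a cheap schedule *)

Section Upper.
Variables (R : archiRealDomainType) (A : {set U}).
Hypotheses (cA : #|A| = k) (clA : {in A &, forall a b, compat a b}).
Local Open Scope ring_scope.

Let T := (k * k)%N.

Definition covered (j : 'I_#|{: job}|) : bool :=
  if enum_val j is inl p then (p.1 \in A) && (p.2 \in A) else false.

Definition job_order : seq 'I_#|{: job}| :=
  [seq j <- enum 'I_#|{: job}| | covered j] ++ [seq j <- enum 'I_#|{: job}| | ~~ covered j].

Lemma card_covered : size [seq j <- enum 'I_#|{: job}| | covered j] = T.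
Proof.
have -> : size [seq j <- enum 'I_#|{: job}| | covered j] = #|[set j | covered j]|.
  rewrite size_filter -sum1_count -sum1_card big_enum_cond.
  by apply: eq_bigl => j; rewrite !inE.
have inj : injective (fun p : U * U => enum_rank (inl p : job)).
  by move=> p q /enum_rank_inj [].
rewrite /T -cA -cardsX -(card_imset (mem (setX A A)) inj); apply: eq_card => j.
rewrite !inE /covered; apply/idP/imsetP.
  by case E: (enum_val j) => [p|//] h; exists p; rewrite -?E ?enum_valK // !inE.
by move=> [p]; rewrite inE => h ->; rewrite enum_rankK.
Qed.

Lemma perm_job_order : perm_eq job_order (enum 'I_#|{: job}|).
Proof. by rewrite /job_order perm_filterC. Qed.

Lemma mem_job_order j : j \in job_order.
Proof. by rewrite (perm_mem perm_job_order) mem_enum. Qed.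

(** The pairs over [A] number exactly [T] and come first, so they fill the slots before [T]. *)
Lemma index_covered j : covered j = (index j job_order < T)%N.
Proof.
rewrite /job_order index_cat mem_filter mem_enum andbT -card_covered.
case: ifP => cj; last by rewrite ltnNge leq_addr.
by rewrite index_mem mem_filter cj mem_enum.
Qed.

Let T0 : (0 < T)%N. Proof. by rewrite muln_gt0 k0. Qed.

Definition clique_repl : seq ({set 'I_#|U|} * R) :=
  [:: ([set i | enum_val i \in A], 0); (setT, T%:R)].

Lemma clique_repl_sorted : sorted <%R [seq q.2 | q <- clique_repl].
Proof. by rewrite /= ltr0n T0. Qed.

Definition clique_solution : solution R clique_jrp :=
  @Solution R clique_jrp [ffun j => (index j job_order)%:R] clique_repl
    clique_repl_sorted.

(** Covered jobs use the replenishment of [A] at time 0; all others start at [T] or later and use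
    the full one. *)
Lemma clique_solution_feasible : feasible clique_solution.
Proof.
split=> [i j ij|j].
  rewrite /completion /= !ffunE -!natrD !ler_nat !addn1.
  have : index i job_order != index j job_order.
    apply: contra ij => /eqP e; rewrite -[X in X == _](nth_index i (mem_job_order i)) e.
    by rewrite nth_index // mem_job_order.
  by rewrite neq_ltn => /orP.
rewrite /ready /= /clique_repl !big_cons big_nil !ffunE /=; apply/subsetP => i.
rewrite !inE => ij; case cj : (covered j).
  move: cj ij; rewrite /covered; case: (enum_val j) => [p|//] /andP[p1 p2] /=.
  rewrite lexx ler0n /= clA // !inE => /orP[]/eqP ->; by rewrite ?p1 ?p2.
have -> : (job_release (enum_val j))%:R <= T%:R :> R.
  by rewrite ler_nat /job_release; case: (enum_val j).
rewrite ler_nat leqNgt -index_covered cj /=.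
by case: ifP; rewrite !inE ?orbT.
Qed.

Lemma clique_solution_cost : total_cost clique_solution = (clique_threshold%:R : R).
Proof.
rewrite clique_thresholdE -addnA natrD /total_cost; congr (_ + _).
  rewrite (eq_bigr (fun j => (index j job_order).+1%:R)); last first.
    by move=> j _; rewrite /completion /= !ffunE natr1.
  rewrite -natr_sum; congr (_%:R).
  under eq_bigr do rewrite -addn1; rewrite big_split /= sum1_card card_ord; congr (_ + _)%N.
  rewrite -big_enum -(perm_big _ perm_job_order) /=.
  have sz : size job_order = #|{: job}|.
    by rewrite (perm_size perm_job_order) size_enum_ord.
  have un : uniq job_order by rewrite (perm_uniq perm_job_order) enum_uniq.
  have j0 : 'I_#|{: job}| by apply: (enum_rank (inl (u0, u0) : job)).
  rewrite (big_nth j0) sz -bin2_sum !big_nat; apply: eq_bigr => i ilt.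
  by rewrite index_uniq ?sz.
have sumK (B : {set 'I_#|U|}) : (\sum_(i in B) K clique_jrp i = #|B|)%N.
  by under eq_bigr do rewrite ffunE; rewrite sum1_card.
rewrite /repl_cost /= /clique_repl !big_cons big_nil !sumK addr0 !add0n cardsT card_ord.
rewrite natrD -{1}cA -(card_imset (mem A) (@enum_rank_inj _)).
congr (_%:R + _); apply: eq_card => i; rewrite !inE; apply/idP/imsetP => [iA|[u uA ->]].
  by exists (enum_val i); rewrite ?enum_valK.
by rewrite enum_rankK.
Qed.

End Upper.

Theorem clique_jrp_correct (R : archiRealDomainType) :
  (exists s : solution R clique_jrp, feasible s /\ (total_cost s <= clique_threshold%:R)%R) <->
  (exists A : {set U}, #|A| = k /\ {in A &, forall a b, compat a b}).
Proof.
split=> [[s [fs cs]]|[A [cA clA]]]; first exact: clique_of_solution fs cs.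
exists (clique_solution R A); split; first exact: clique_solution_feasible.
by rewrite clique_solution_cost.
Qed.

End CliqueJrp.

(** * Computations as cliques *)

Definition moves_left (m : move) : bool := if m is MoveL then true else false.
Definition moves_right (m : move) : bool := if m is MoveR then true else false.

Section Tableau.
Variable M : TM.

Definition symbols : finType := {ffun 'I_(tm_work M).+1 -> option (bool + tm_gamma M)}.

(** A halting state rewrites what it reads and stays, so that one rule describes every step. *)
Definition act (q : tm_state M) (rd : symbols) :
    tm_state M * {ffun 'I_(tm_work M).+1 -> option (bool + tm_gamma M) * move} :=
  if tm_halt q then (q, [ffun k => (rd k, Stay)]) else tm_delta q rd.

Definition scanned (C : config M) : symbols := [ffun k => cell (C.2 k) 0].

Lemma step_state (C : config M) : (step C).1 = (act C.1 (scanned C)).1.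
Proof.
by rewrite /step /act /halted; case: ifP.
Qed.

Lemma step_cell (C : config M) k j : let a := (act C.1 (scanned C)).2 k in
  cell ((step C).2 k) j =
  if (j + shift a.2 == 0)%R then a.1 else cell (C.2 k) (j + shift a.2)%R.
Proof.
rewrite /step /act /halted; case: ifP => _ /=.
  by rewrite !ffunE /= addr0; case: eqP => // ->.
by rewrite ffunE cell_act.
Qed.

(* A tile is a state, the vector of scanned symbols and the vector of symbols at
   one position.  The row is the time, the column [i] the position [i - T]
   relative to the heads. *)
Definition tile : finType := (tm_state M * symbols * symbols)%type.
Implicit Type v : tile.

Variables (T p : nat) (y : seq bool).

(** Column [T] is cell 0: [y] starts there, followed by [p] cells whose bit or blank is guessed, and
    blanks elsewhere. *)
Definition init_ok (i : nat) (c : symbols) : bool :=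
  [forall k, (k != ord0) ==> (c k == None)] &&
  match c ord0 with
  | None => (i < T) || (T + size y <= i)
  | Some (inl b) =>
      [&& T <= i, i < T + size y & nth false y (i - T) == b] ||
      (T + size y <= i) && (i < T + size y + p)
  | Some (inr _) => false
  end.

Definition tile_ok (t i : nat) v : bool :=
  [&& (i == T) ==> (v.1.2 == v.2),
      (t == 0) ==> (v.1.1 == tm_start M) && init_ok i v.2 &
      (t == T) && (i == T) ==> (v.2 ord0 == Some (inl true))].

(** All tiles of a row share state and scanned symbols, and a clique has at most one tile per time
    and position. *)
Definition same_row_ok (i i' : nat) v v' : bool :=
  (v.1 == v'.1) && ((i == i') ==> (v == v')).

(** The equation between columns says that column [i] and column [i'] of the next row show the same
    cell of tape [k]; moves are added on both sides to avoid subtraction. *)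
Definition next_row_ok (i i' : nat) v v' : bool :=
  let a := act v.1.1 v.1.2 in
  (v'.1.1 == a.1) &&
  [forall k, (i + moves_left (a.2 k).2 == i' + moves_right (a.2 k).2) ==>
             (v'.2 k == if i == T then (a.2 k).1 else v.2 k)].

(* In the guessed part of the input no bit follows a blank. *)
Definition guess_ok (i i' : nat) v v' : bool :=
  (i.+1 == i') && (T + size y <= i) ==> (v.2 ord0 == None) ==> (v'.2 ord0 == None).

(** Not symmetric: cliques are tested on all ordered pairs, equal ones included, so [tile_ok] is
    imposed on every member. *)
Definition compat_at (t i : nat) v (t' i' : nat) v' : bool :=
  [&& tile_ok t i v, (t == t') ==> same_row_ok i i' v v',
      (t.+1 == t') ==> next_row_ok i i' v v' &
      (t == 0) && (t' == 0) ==> guess_ok i i' v v'].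

Definition node : finType := ('I_T.+1 * 'I_T.*2.+1 * tile)%type.

Definition compat (a b : node) : bool :=
  compat_at a.1.1 a.1.2 a.2 b.1.1 b.1.2 b.2.

Definition grid : nat := T.+1 * T.*2.+1.

Hypothesis yT : size y + p <= T.

(** Nodes of a clique have distinct coordinates, and there are [grid] of them, so every coordinate
    carries exactly one tile. *)
Lemma clique_assignment (A : {set node}) :
  #|A| = grid -> {in A &, forall a b, compat a b} ->
  exists f : nat -> nat -> tile, forall t i t' i',
    t <= T -> i <= T.*2 -> t' <= T -> i' <= T.*2 ->
    compat_at t i (f t i) t' i' (f t' i').
Proof.
move=> cA clA.
have inj : {in A &, injective (fun a : node => a.1)}.
  move=> [[t i] v] [[t' i'] v'] aA bA /= e; move: e aA bA => [<- <-] aA bA.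
  have /and4P[_ + _ _] := clA _ _ aA bA; rewrite /same_row_ok /= !eqxx /=.
  by move=> /andP[_ /eqP ->].
have full : [set a.1 | a in A] = setT.
  apply/eqP; rewrite eqEcard subsetT cardsT card_in_imset // cA.
  by rewrite card_prod !card_ord /grid leqnn.
have ex (q : 'I_T.+1 * 'I_T.*2.+1) : exists v, (q, v) \in A.
  have : q \in [set a.1 | a in A] by rewrite full inE.
  by case/imsetP => -[q' v] aA /= ->; exists v.
exists (fun t i => xchoose (ex (inord t, inord i))) => t i t' i' tT iT tT' iT'.
have := clA _ _ (xchooseP (ex (inord t, inord i))) (xchooseP (ex (inord t', inord i'))).
by rewrite /compat /= !inordK.
Qed.

Lemma assignment_clique (f : nat -> nat -> tile) :
  (forall t i t' i', t <= T -> i <= T.*2 -> t' <= T -> i' <= T.*2 ->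
    compat_at t i (f t i) t' i' (f t' i')) ->
  exists A : {set node}, #|A| = grid /\ {in A &, forall a b, compat a b}.
Proof.
move=> h; pose g (q : 'I_T.+1 * 'I_T.*2.+1) : node := (q, f q.1 q.2).
exists [set g q | q in [set: 'I_T.+1 * 'I_T.*2.+1]]; split.
  by rewrite card_imset ?cardsT ?card_prod ?card_ord // => q q' [].
move=> _ _ /imsetP[[t i] _ ->] /imsetP[[t' i'] _ ->].
by apply: h; rewrite -ltnS ltn_ord.
Qed.

Definition col_pos (i : nat) : int := (i%:Z - T%:Z)%R.

Lemma col_pos0 i : (col_pos i == 0)%R = (i == T).
Proof. by rewrite /col_pos; lia. Qed.

Lemma shiftE m i i' :
  (i + moves_left m == i' + moves_right m) = (col_pos i == col_pos i' + shift m)%R.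
Proof. by rewrite /col_pos; case: m => /=; lia. Qed.

Lemma cell_init0 x j : cell ((init M x).2 ord0) j = word_cell (bits_of M x) j.
Proof. by rewrite ffunE eqxx; case: j => //= k; rewrite nth_nil. Qed.

Lemma cell_init x k j : k != ord0 -> cell ((init M x).2 k) j = None.
Proof. by move=> /negPf kn; rewrite ffunE kn; case: j => i /=; rewrite nth_nil. Qed.

Definition accepts (w : seq bool) : Prop :=
  cell ((iter T (@step M) (init M (y ++ w))).2 ord0) 0 = Some (inl true).

Lemma accepts_assignment w : size w <= p -> accepts w ->
  exists f : nat -> nat -> tile, forall t i t' i',
    t <= T -> i <= T.*2 -> t' <= T -> i' <= T.*2 ->
    compat_at t i (f t i) t' i' (f t' i').
Proof.
move=> wp acc; pose C t := iter t (@step M) (init M (y ++ w)).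
pose f t i : tile := ((C t).1, scanned (C t), [ffun k => cell ((C t).2 k) (col_pos i)]).
have nthE b : nth None (bits_of M (y ++ w)) b =
   if b < size y + size w then Some (inl (nth false (y ++ w) b)) else None.
  case: ltnP => h; first by rewrite (nth_map false) // size_cat.
  by rewrite nth_default // size_map size_cat.
exists f => t i t' i' tT iT tT' iT'; apply/and4P; split.
- apply/and3P; split.
  + apply/implyP => /eqP ->; apply/eqP/ffunP => k; rewrite !ffunE.
    by rewrite /col_pos subrr.
  + apply/implyP => /eqP -> /=; rewrite eqxx /=; apply/andP; split.
      by apply/forallP => k; apply/implyP => kn; rewrite ffunE cell_init.
    rewrite ffunE cell_init0 /col_pos.
    case: (ltnP i T) => iT0.
      by case E : (i%:Z - T%:Z)%R => [m|m] //; lia.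
    have -> : (i%:Z - T%:Z)%R = Posz (i - T) by lia.
    rewrite /= nthE; case: ltnP => h; last by lia.
    rewrite nth_cat; case: (ltnP (i - T) (size y)) => h'.
      by rewrite eqxx (_ : i < T + size y) //; lia.
    by apply/orP; right; lia.
  + by apply/implyP => /andP[/eqP -> /eqP ->]; rewrite ffunE /col_pos subrr; apply/eqP.
- apply/implyP => /eqP <-; rewrite /same_row_ok eqxx /=.
  by apply/implyP => /eqP ->.
- apply/implyP => /eqP <-; rewrite /next_row_ok /= -step_state eqxx /=.
  apply/forallP => k; apply/implyP; rewrite shiftE => /eqP e.
  by rewrite !ffunE step_cell -e -col_pos0.
- apply/implyP => /andP[/eqP -> /eqP ->]; apply/implyP => /andP[/eqP <- le].
  have fE j : (f 0 j).2 ord0 = word_cell (bits_of M (y ++ w)) (col_pos j).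
    by rewrite ffunE cell_init0.
  rewrite !fE /col_pos.
  have -> : (i%:Z - T%:Z)%R = Posz (i - T) by lia.
  have -> : (i.+1%:Z - T%:Z)%R = Posz (i.+1 - T) by lia.
  rewrite /= !nthE; case: (ltnP (i - T)) => //= h; case: (ltnP (i.+1 - T)) => // h'.
  by exfalso; lia.
Qed.

(** If blanks persist, the bits before the first blank determine all of [s]. *)
Lemma bits_prefix_monotone (s : seq (sym M)) :
  (forall m, match nth None s m with
             | None => nth None s m.+1 = None
             | Some (inl _) => True
             | Some (inr _) => False
             end) ->
  forall m, nth None s m = nth None (bits_of M (bits_prefix s)) m.
Proof.
elim: s => [|c s IH] h m /=; first by rewrite !nth_nil.
case: c h => [[b|g]|] h; [|by have := h 0|].
  by case: m => //= m; apply: IH => m'; exact: (h m'.+1).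
rewrite nth_nil; elim: m => // m IHm.
by have := h m; rewrite IHm.
Qed.

Lemma size_bits_prefix (s : seq (sym M)) : size (bits_prefix s) <= size s.
Proof. by elim: s => //= -[[b|g]|] s IH. Qed.

(** The witness is read from the guessed cells of row 0, and the rows are then shown to follow the
    run on it. *)
Lemma assignment_accepts (f : nat -> nat -> tile) :
  (forall t i t' i', t <= T -> i <= T.*2 -> t' <= T -> i' <= T.*2 ->
    compat_at t i (f t i) t' i' (f t' i')) ->
  exists2 w, size w <= p & accepts w.
Proof.
move=> h.
have ok t i : t <= T -> i <= T.*2 -> tile_ok t i (f t i).
  by move=> tT iT; have /and4P[] := h t i t i tT iT tT iT.
have row t i i' : t <= T -> i <= T.*2 -> i' <= T.*2 -> (f t i).1 = (f t i').1.
  move=> tT iT iT'; have /and4P[_ + _ _] := h t i t i' tT iT tT iT'.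
  by rewrite eqxx => /andP[/eqP].
have next t i i' : t < T -> i <= T.*2 -> i' <= T.*2 -> next_row_ok i i' (f t i) (f t.+1 i').
  move=> tT iT iT'; have /and4P[_ _ + _] := h t i t.+1 i' (ltnW tT) iT tT iT'.
  by rewrite eqxx.
have guess i : i < T.*2 -> T + size y <= i ->
    (f 0 i).2 ord0 = None -> (f 0 i.+1).2 ord0 = None.
  move=> iT le /eqP e; have /and4P[_ _ _] := h 0 i 0 i.+1 isT (ltnW iT) isT iT.
  by rewrite /guess_ok !eqxx le e => /eqP.
have init0 i : i <= T.*2 -> init_ok i (f 0 i).2 /\ (f 0 i).1.1 = tm_start M.
  by move=> iT; have /and3P[_ /andP[/eqP ? ?] _] := ok 0 i isT iT.
have read t : t <= T -> (f t T).1.2 = (f t T).2.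
  by move=> tT; have /and3P[] := ok t T tT ltac:(lia); rewrite eqxx => /eqP.
pose s := [seq (f 0 (T + size y + m)).2 ord0 | m <- iota 0 p].
have sE m : m < p -> nth None s m = (f 0 (T + size y + m)).2 ord0.
  by move=> mp; rewrite (nth_map 0) ?size_iota // nth_iota.
pose w := bits_prefix s.
have wE : forall m, nth None s m = nth None (bits_of M w) m.
  apply: bits_prefix_monotone => m; case: (ltnP m p) => mp; last first.
    by rewrite !nth_default ?size_map ?size_iota //; lia.
  rewrite sE //.
  have [|] := init0 (T + size y + m); first by lia.
  case/andP => _; case E: ((f 0 _).2 ord0) => [[b|g]|] // _ _.
  case: (ltnP m.+1 p) => mp'; last by rewrite nth_default // size_map size_iota.
  by rewrite sE // addnS guess //; lia.
exists w; first by apply: leq_trans (size_bits_prefix _) _; rewrite size_map size_iota.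
pose C t := iter t (@step M) (init M (y ++ w)).
(* A cell moves by at most one column per step, so information from outside the grid has not reached
   columns [t] to [T.*2 - t] of row [t]. In row [T] the column [T] remains, which decides
   acceptance. *)
have main t : t <= T -> (f t T).1.1 = (C t).1 /\
    forall i k, t <= i -> i + t <= T.*2 -> (f t i).2 k = cell ((C t).2 k) (col_pos i).
  elim: t => [|t IH] tT.
    split; first by have [|_ ->] := init0 T; [lia|].
    move=> i k _ iT; have [|] := init0 i; first by lia.
    case/andP => /forallP/(_ k) + + _.
    case: (eqVneq k ord0) => [->|kn] /= hk; last by rewrite cell_init // => _; apply/eqP.
    rewrite /C /= cell_init0 /col_pos.
    case: (ltnP i T) => iT0.
      have -> : word_cell (bits_of M (y ++ w)) (i%:Z - T%:Z)%R = None.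
        by case E : (i%:Z - T%:Z)%R => [m|m] //; lia.
      by case: ((f 0 i).2 ord0) => [[b|g]|] //; lia.
    have -> : (i%:Z - T%:Z)%R = Posz (i - T) by lia.
    rewrite /= /bits_of map_cat nth_cat size_map.
    case: (ltnP (i - T) (size y)) => hi.
      rewrite (nth_map false) //; case: ((f 0 i).2 ord0) => [[b|g]|] //; last by lia.
      case/orP => [hb|]; last by lia.
      have /eqP -> // : nth false y (i - T) == b.
      by move: hb; case: (_ == b) => //; rewrite ?andbF.
    rewrite -/(bits_of M w) -wE => hi'.
    case: (ltnP (i - T - size y) p) => ip.
      by rewrite sE //; congr ((f 0 _).2 _); lia.
    rewrite nth_default ?size_map ?size_iota //.
    by case: ((f 0 i).2 ord0) hi' => [[b|g]|] //; lia.
  have [q0 c0] := IH (ltnW tT).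
  have sc : (f t T).1.2 = scanned (C t).
    rewrite read 1?ltnW //; apply/ffunP => k; rewrite !ffunE c0; try lia.
    by rewrite /col_pos subrr.
  have actE i : i <= T.*2 -> act (f t i).1.1 (f t i).1.2 = act (C t).1 (scanned (C t)).
    by move=> iT; rewrite (row t i T) ?q0 ?sc //; lia.
  split.
    have /andP[/eqP -> _] := next t T T tT ltac:(lia) ltac:(lia).
    by rewrite actE ?step_state //; lia.
  move=> i k ti iT; rewrite /C iterS -/(C t) step_cell /=.
  set a := (act _ _).2 k.
  (* The column that showed this cell in the previous row. *)
  pose i0 := i + moves_right a.2 - moves_left a.2.
  have e0 : i0 + moves_left a.2 == i + moves_right a.2 by rewrite /i0; case: (a.2) => /=; lia.
  have i0T : i0 + t <= T.*2 by rewrite /i0; case: (a.2) => /=; lia.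
  have ti0 : t <= i0 by rewrite /i0; case: (a.2) => /=; lia.
  have /andP[_ /forallP/(_ k)] := next t i0 i tT ltac:(lia) ltac:(lia).
  rewrite actE; last by lia.
  rewrite -/a e0 /= => /eqP ->; rewrite -col_pos0 c0 //.
  by move: e0; rewrite shiftE => /eqP ->.
have [_ c0] := main T (leqnn T); rewrite /accepts -/(C T).
have -> : 0%R = col_pos T by rewrite /col_pos subrr.
rewrite -c0; try lia.
have /and3P[_ _] := ok T T (leqnn T) ltac:(lia).
by rewrite eqxx => /eqP.
Qed.

Theorem tableau_correct :
  (exists A : {set node}, #|A| = grid /\ {in A &, forall a b, compat a b}) <->
  (exists2 w, size w <= p & accepts w).
Proof.
split=> [[A [cA clA]]|[w wp acc]].
  by have [f hf] := clique_assignment cA clA; apply: assignment_accepts hf.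
by have [f hf] := accepts_assignment wp acc; apply: assignment_clique hf.
Qed.

End Tableau.

(** * The encoding of the instance *)

(** The value of a [For] loop is by definition such a concatenation over [iota]. *)
Definition catmap (S : Type) (F : S -> seq bool) (s : seq S) := flatten (map F s).

Lemma catmap_cat (S : Type) F (s1 s2 : seq S) :
  catmap F (s1 ++ s2) = catmap F s1 ++ catmap F s2.
Proof. by rewrite /catmap map_cat flatten_cat. Qed.

Lemma catmap_map (S S' : Type) F (g : S' -> S) s :
  catmap F (map g s) = catmap (fun x => F (g x)) s.
Proof. by rewrite /catmap -map_comp. Qed.

Lemma catmap_allpairs (S1 S2 S : Type) (g : S1 -> S2 -> S) F s1 s2 :
  catmap F [seq g x1 x2 | x1 <- s1, x2 <- s2] =
  catmap (fun x1 => catmap (fun x2 => F (g x1 x2)) s2) s1.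
Proof. by elim: s1 => //= x1 s1 IH; rewrite catmap_cat catmap_map IH. Qed.

Lemma eq_catmap (S : Type) (F G : S -> seq bool) s : F =1 G -> catmap F s = catmap G s.
Proof. by move=> /eq_map e; rewrite /catmap e. Qed.

Lemma catmap_const (S S' : Type) w (s : seq S) (s' : seq S') :
  size s = size s' -> catmap (fun=> w) s = catmap (fun=> w) s'.
Proof.
by elim: s s' => [|x s IH] [|x' s'] //= [/IH]; rewrite /catmap /= => ->.
Qed.

(** The enumeration is lexicographic, hence the order in which nested loops print. *)
Lemma enum_prodE (T1 T2 : finType) :
  enum {: T1 * T2} = [seq (x, y) | x <- enum T1, y <- enum T2].
Proof. by rewrite [LHS]enumT [Finite.enum]unlock. Qed.

Lemma catmap_prod (T1 T2 : finType) (F : T1 * T2 -> seq bool) :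
  catmap F (enum {: T1 * T2}) =
  catmap (fun a => catmap (fun b => F (a, b)) (enum T2)) (enum T1).
Proof. by rewrite enum_prodE catmap_allpairs. Qed.

Lemma enum_sumE (T1 T2 : finType) :
  enum {: T1 + T2} = map inl (enum T1) ++ map inr (enum T2).
Proof. by rewrite [LHS]enumT [Finite.enum]unlock /= /sum_enum -!enumT. Qed.

Lemma catmap_sum (T1 T2 : finType) (F : T1 + T2 -> seq bool) :
  catmap F (enum {: T1 + T2}) =
  catmap (fun a => F (inl a)) (enum T1) ++ catmap (fun b => F (inr b)) (enum T2).
Proof. by rewrite enum_sumE catmap_cat; congr (_ ++ _); apply: catmap_map. Qed.

Lemma catmap_ord m F : catmap (fun i : 'I_m => F (val i)) (enum 'I_m) = catmap F (iota 0 m).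
Proof. by rewrite -val_enum_ord catmap_map. Qed.

Lemma map_enum_val (T : finType) (x0 : T) :
  [seq enum_val i | i <- enum 'I_#|T|] = enum T.
Proof.
rewrite (eq_map (enum_val_nth x0)) (map_comp (nth x0 (enum T)) val) val_enum_ord.
by rewrite cardE map_nth_iota0 // take_size.
Qed.

Definition nat_code (m : nat) : seq bool := delimit (bin m).

Lemma enc_natsE s : enc_nats s = catmap nat_code s.
Proof. by []. Qed.

(** * Compatibility as an arithmetic formula *)

Section Formulas.
Variables (y : seq bool) (env : seq nat).

Definition denotes (e : expr) (b : bool) := eval y env e = nat_of_bool b.

Definition eNot a := Minus (Cst 1) a.
Definition eAnd a b := Mul a b.
Definition eOr a b := eNot (eAnd (eNot a) (eNot b)).
Definition eImp a b := eNot (eAnd a (eNot b)).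
Definition eLe a b := Minus (Cst 1) (Minus a b).
Definition eLt a b := eLe (Add a (Cst 1)) b.
Definition eEq a b := eAnd (eLe a b) (eLe b a).
Definition eBool (b : bool) := Cst b.
Definition eAll (s : seq expr) := foldr eAnd (Cst 1) s.

Lemma denotes_not a p : denotes a p -> denotes (eNot a) (~~ p).
Proof. by rewrite /denotes /= => ->; case: p. Qed.

Lemma denotes_and a b p q : denotes a p -> denotes b q -> denotes (eAnd a b) (p && q).
Proof. by rewrite /denotes /= => -> ->; case: p; case: q. Qed.

Lemma denotes_or a b p q : denotes a p -> denotes b q -> denotes (eOr a b) (p || q).
Proof. by rewrite /denotes /= => -> ->; case: p; case: q. Qed.

Lemma denotes_imp a b p q : denotes a p -> denotes b q -> denotes (eImp a b) (p ==> q).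
Proof. by rewrite /denotes /= => -> ->; case: p; case: q. Qed.

Lemma denotes_le a b m n : eval y env a = m -> eval y env b = n -> denotes (eLe a b) (m <= n).
Proof. by rewrite /denotes /= => -> ->; lia. Qed.

Lemma denotes_lt a b m n : eval y env a = m -> eval y env b = n -> denotes (eLt a b) (m < n).
Proof. by rewrite /denotes /= => -> ->; lia. Qed.

Lemma denotes_eq a b m n : eval y env a = m -> eval y env b = n -> denotes (eEq a b) (m == n).
Proof. by rewrite /denotes /= => -> ->; lia. Qed.

Lemma denotes_all (T : finType) (F : T -> expr) (P : pred T) :
  (forall k, denotes (F k) (P k)) -> denotes (eAll (map F (enum T))) [forall k, P k].
Proof.
move=> h; have -> : [forall k, P k] = all P (enum T).
  by apply/forallP/allP => hP k; [move=> _|]; apply: hP; rewrite ?mem_enum.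
by elim: (enum T) => //= k s; apply: denotes_and.
Qed.

End Formulas.

Section CompatExpr.
Variable M : TM.
Variables (eT eY eP : expr).
Implicit Type v : tile M.

(** Tiles range over a finite set fixed by [M], so conditions on them become constants; only
    coordinates and input bits are evaluated at run time. *)
Definition init_okE (i : expr) (c : symbols M) : expr :=
  eAnd (eBool [forall k, (k != ord0) ==> (c k == None)])
  match c ord0 with
  | None => eOr (eLt i eT) (eLe (Add eT eY) i)
  | Some (inl b) =>
      eOr (eAnd (eLe eT i) (eAnd (eLt i (Add eT eY)) (eEq (Bit (Minus i eT)) (eBool b))))
          (eAnd (eLe (Add eT eY) i) (eLt i (Add (Add eT eY) eP)))
  | Some (inr _) => eBool false
  end.

Definition tile_okE (t i : expr) v : expr :=
  eAnd (eImp (eEq i eT) (eBool (v.1.2 == v.2)))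
  (eAnd (eImp (eEq t (Cst 0)) (eAnd (eBool (v.1.1 == tm_start M)) (init_okE i v.2)))
        (eImp (eAnd (eEq t eT) (eEq i eT)) (eBool (v.2 ord0 == Some (inl true))))).

Definition same_row_okE (i i' : expr) v v' : expr :=
  eAnd (eBool (v.1 == v'.1)) (eImp (eEq i i') (eBool (v == v'))).

Definition next_row_okE (i i' : expr) v v' : expr :=
  let a := act v.1.1 v.1.2 in
  eAnd (eBool (v'.1.1 == a.1))
  (eAll [seq eImp (eEq (Add i (eBool (moves_left (a.2 k).2)))
                       (Add i' (eBool (moves_right (a.2 k).2))))
              (eAnd (eImp (eEq i eT) (eBool (v'.2 k == (a.2 k).1)))
                    (eImp (eNot (eEq i eT)) (eBool (v'.2 k == v.2 k))))
        | k <- enum 'I_(tm_work M).+1]).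

Definition guess_okE (i i' : expr) v v' : expr :=
  eImp (eAnd (eEq (Add i (Cst 1)) i') (eLe (Add eT eY) i))
       (eBool ((v.2 ord0 == None) ==> (v'.2 ord0 == None))).

Definition compatE (t i : expr) v (t' i' : expr) v' : expr :=
  eAnd (tile_okE t i v)
  (eAnd (eImp (eEq t t') (same_row_okE i i' v v'))
  (eAnd (eImp (eEq (Add t (Cst 1)) t') (next_row_okE i i' v v'))
        (eImp (eAnd (eEq t (Cst 0)) (eEq t' (Cst 0))) (guess_okE i i' v v')))).

Variables (y : seq bool) (env : seq nat) (T p : nat).
Hypotheses (hT : eval y env eT = T) (hY : eval y env eY = size y) (hP : eval y env eP = p).

Lemma denotes_compat t i v t' i' v' et ei et' ei' :
  eval y env et = t -> eval y env ei = i -> eval y env et' = t' -> eval y env ei' = i' ->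
  denotes y env (compatE et ei v et' ei' v') (compat_at T p y t i v t' i' v').
Proof.
move=> ht hi ht' hi'.
have hTY : eval y env (Add eT eY) = T + size y by rewrite /= hT hY.
have h1 e m : eval y env e = m -> eval y env (Add e (Cst 1)) = m.+1.
  by move=> /= ->; rewrite addn1.
apply: denotes_and; [|apply: denotes_and; [|apply: denotes_and]].
- apply: denotes_and; [|apply: denotes_and].
  + by apply: denotes_imp => //; apply: denotes_eq.
  + apply: denotes_imp; first exact: denotes_eq.
    apply: denotes_and => //; rewrite /init_ok /init_okE; apply: denotes_and => //.
    case: (v.2 ord0) => [[b|g]|] //.
      apply: denotes_or; last first.
        by apply: denotes_and; [apply: denotes_le|apply: denotes_lt => //=; rewrite hT hY hP].
      apply: denotes_and; first exact: denotes_le.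
      apply: denotes_and; first exact: denotes_lt.
      have -> : (nth false y (i - T) == b) = (nat_of_bool (nth false y (i - T)) == b).
        by case: nth; case: b.
      by apply: denotes_eq; rewrite //= hi hT.
    by apply: denotes_or; [apply: denotes_lt|apply: denotes_le].
  + by apply: denotes_imp => //; apply: denotes_and; apply: denotes_eq.
- apply: denotes_imp; first exact: denotes_eq.
  by apply: denotes_and => //; apply: denotes_imp => //; apply: denotes_eq.
- apply: denotes_imp; first by apply: denotes_eq => //; apply: h1.
  apply: denotes_and => //; apply: denotes_all => k.
  apply: denotes_imp; first by apply: denotes_eq; rewrite /= ?hi ?hi'.
  set a := (act _ _).2 k.
  have -> : (v'.2 k == if i == T then a.1 else v.2 k) =
     ((i == T) ==> (v'.2 k == a.1)) && (~~ (i == T) ==> (v'.2 k == v.2 k)).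
    by case: (i == T); rewrite ?andbT.
  apply: denotes_and; apply: denotes_imp => //; first exact: denotes_eq.
  by apply: denotes_not; apply: denotes_eq.
- apply: denotes_imp; first by apply: denotes_and; apply: denotes_eq.
  apply: denotes_imp => //; apply: denotes_and; last exact: denotes_le.
  by apply: denotes_eq => //; apply: h1.
Qed.

End CompatExpr.

(** * The instance and the program that prints it *)

Section Reduction.
Variables (M : TM) (c d cw dw : nat).

Definition witness_bound (n : nat) := poly_bound cw dw n.
(** The greatest length of an input paired with an admissible witness. *)
Definition input_bound (n : nat) := n + n + 1 + witness_bound n.
(** Bounds the running time of the verifier; the second summand makes the input and the guess fit
    into the columns from [T] on. *)
Definition horizon (n : nat) := poly_bound c d (input_bound n) + input_bound n.

Definition ePoly (a b : nat) (e : expr) : expr :=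
  Add (Mul (Cst a) (iter b (Mul e) (Cst 1))) (Cst a).
Definition eWitness (e : expr) := ePoly cw dw e.
Definition eDelimit (e : expr) := Add (Add e e) (Cst 1).
Definition eInput (e : expr) := Add (eDelimit e) (eWitness e).
Definition eHorizon (e : expr) := Add (ePoly c d (eInput e)) (eInput e).
Definition eRows (e : expr) := Add (eHorizon e) (Cst 1).
Definition eCols (e : expr) := Add (Add (eHorizon e) (eHorizon e)) (Cst 1).
Definition eGrid (e : expr) := Mul (eRows e) (eCols e).
Definition eNodes (e : expr) := Mul (eGrid e) (Cst #|tile M|).
Definition eHalf (e : expr) := Add (Add (Mul (eNodes e) (eNodes e)) (eGrid e)) (Cst 1).
Definition eLate (e : expr) := Add (Add (eHalf e) (eGrid e)) (Cst 1).
Definition eJobs (e : expr) := Add (eHalf e) (eHalf e).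
Definition eThreshold (e : expr) :=
  Add (Add (Mul (eHalf e) (Add (eJobs e) (Cst 1))) (eGrid e)) (eNodes e).

Section Values.
Variables (y : seq bool) (env : seq nat) (e : expr).

Lemma eval_poly a b f : eval y env (ePoly a b f) = poly_bound a b (eval y env f).
Proof.
rewrite /poly_bound /ePoly /=; congr (_ * _ + _).
by elim: b => //= b ->; rewrite expnS.
Qed.

Lemma eval_input : eval y env (eInput e) = input_bound (eval y env e).
Proof. by rewrite /input_bound /witness_bound -eval_poly. Qed.

Lemma eval_horizon : eval y env (eHorizon e) = horizon (eval y env e).
Proof. by rewrite /horizon -eval_input -eval_poly. Qed.

Lemma eval_rows : eval y env (eRows e) = (horizon (eval y env e)).+1.
Proof. by rewrite -eval_horizon -addn1. Qed.

Lemma eval_cols : eval y env (eCols e) = (horizon (eval y env e)).*2.+1.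
Proof. by rewrite -eval_horizon -addnn -addn1. Qed.

Lemma eval_grid : eval y env (eGrid e) = grid (horizon (eval y env e)).
Proof. by rewrite /grid -eval_rows -eval_cols. Qed.

Lemma eval_nodes : eval y env (eNodes e) = #|node M (horizon (eval y env e))|.
Proof. by rewrite card_prod card_prod !card_ord -eval_rows -eval_cols. Qed.

Local Notation nodes := (node M (horizon (eval y env e))).
Local Notation k := (grid (horizon (eval y env e))).

Lemma eval_half : eval y env (eHalf e) = half_jobs nodes k.
Proof. by rewrite /half_jobs -eval_nodes -eval_grid. Qed.

Lemma eval_late : eval y env (eLate e) = late_jobs nodes k.
Proof. by rewrite /late_jobs -eval_half -eval_grid. Qed.

Lemma eval_jobs : eval y env (eJobs e) = #|{: job nodes k}|.
Proof. by rewrite card_job -addnn -eval_half. Qed.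

Lemma eval_threshold : eval y env (eThreshold e) = clique_threshold nodes k.
Proof. by rewrite /clique_threshold -addnn -eval_half -eval_grid -eval_nodes. Qed.

End Values.

Definition gen_cat (s : seq gen) : gen := foldr Cat (Lit [::]) s.

Lemma gen_eval_cat y env s : gen_eval y env (gen_cat s) = catmap (gen_eval y env) s.
Proof. by elim: s => //= g s ->. Qed.

(** Rows and columns depend on the input length, which is variable [m], and are run through by
    loops; the tiles depend on [M] only and are unrolled. *)
Definition for_node (m : nat) (G : tile M -> gen) : gen :=
  For (eRows (Var m)) (For (eCols (Var m.+1)) (gen_cat (map G (enum (tile M))))).

Lemma gen_eval_for_node y env m G (F : node M (horizon (nth 0 env m)) -> seq bool) :
  (forall u, gen_eval y [:: val u.1.2, val u.1.1 & env] (G u.2) = F u) ->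
  gen_eval y env (for_node m G) = catmap F (enum (node M (horizon (nth 0 env m)))).
Proof.
move=> h; rewrite [RHS]catmap_prod [RHS]catmap_prod.
rewrite -[LHS]/(catmap _ (iota 0 (eval _ _ _))) eval_rows -catmap_ord.
apply: eq_catmap => t; rewrite -[LHS]/(catmap _ (iota 0 (eval _ _ _))) eval_cols -catmap_ord.
apply: eq_catmap => i.
rewrite -[LHS]/(gen_eval y [:: val i, val t & env] (gen_cat (map G (enum (tile M))))).
rewrite gen_eval_cat catmap_map.
by apply: eq_catmap => v; rewrite -(h (t, i, v)).
Qed.

Definition gen_one : gen := Lit (nat_code 1).
Definition gen_zero : gen := Lit (nat_code 0).

(* Evaluated in an environment [:: i3; t3; i2; t2; i1; t1; n]. *)
Definition eReq (v1 v2 v3 : tile M) : expr :=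
  eOr (eNot (compatE (eHorizon (Var 6)) (eDelimit (Var 6)) (eWitness (Var 6))
               (Var 5) (Var 4) v1 (Var 3) (Var 2) v2))
      (eOr (eAnd (eAnd (eEq (Var 1) (Var 5)) (eEq (Var 0) (Var 4))) (eBool (v3 == v1)))
           (eAnd (eAnd (eEq (Var 1) (Var 3)) (eEq (Var 0) (Var 2))) (eBool (v3 == v2)))).

(** Each enclosing [for_node] has pushed two counters, which moves the input length from variable 0
    to 2 and 4. *)
Definition gen_req : gen :=
  for_node 0 (fun v1 => for_node 2 (fun v2 => for_node 4 (fun v3 =>
    Cond (eReq v1 v2 v3) gen_one gen_zero))).

(** Follows the threshold and [jrp_data] entry by entry. Release dates and requirements take two
    items each, pair jobs before late jobs. *)
Definition gen_jrp : gen :=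
  gen_cat [:: Bin (eThreshold (Var 0)); Bin (eJobs (Var 0)); Bin (eNodes (Var 0)); gen_zero;
    For (eNodes (Var 0)) gen_one;
    For (eJobs (Var 0)) gen_one;
    For (Mul (eNodes (Var 0)) (eNodes (Var 0))) gen_zero;
    For (eLate (Var 0)) (Bin (Mul (eGrid (Var 1)) (eGrid (Var 1))));
    gen_req;
    For (eLate (Var 0)) (For (eNodes (Var 1)) gen_one)].

Variable x : seq bool.
Let n := size x.
Let T := horizon n.
Let y := delimit x.
Let U := node M T.

Definition tile0 : tile M := (tm_start M, [ffun=> None], [ffun=> None]).
Definition node0 : U := (ord0, ord0, tile0).

Definition reduction : jrp * nat :=
  (clique_jrp (@compat M T (witness_bound n) y) (grid T) node0,
   clique_threshold U (grid T)).

Local Notation J := (job U (grid T)).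

Lemma gen_eval_req (u1 u2 u3 : U) :
  gen_eval y [:: val u3.1.2; val u3.1.1; val u2.1.2; val u2.1.1; val u1.1.2; val u1.1.1; n]
    (Cond (eReq u1.2 u2.2 u3.2) gen_one gen_zero) =
  nat_code (u3 \in job_req (@compat M T (witness_bound n) y) (inl (u1, u2) : J)).
Proof.
set env := [:: _, _ & _].
have e1 u (et ei : expr) : eval y env et = val u.1.1 -> eval y env ei = val u.1.2 ->
  denotes y env (eAnd (eAnd (eEq (Var 1) et) (eEq (Var 0) ei)) (eBool (u3.2 == u.2))) (u3 == u).
  move=> ht hi; have -> : (u3 == u) =
    (val u3.1.1 == val u.1.1) && (val u3.1.2 == val u.1.2) && (u3.2 == u.2).
    by case: (u3) u {ht hi} => [[? ?] ?] [[? ?] ?].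
  by apply: denotes_and => //; apply: denotes_and; apply: denotes_eq.
have e2 := @denotes_compat M (eHorizon (Var 6)) (eDelimit (Var 6)) (eWitness (Var 6)) y env T
  (witness_bound n) (eval_horizon y env (Var 6)) (esym (size_delimit x))
  (eval_poly y env cw dw (Var 6))
  _ _ u1.2 _ _ u2.2 (Var 5) (Var 4) (Var 3) (Var 2) erefl erefl erefl erefl.
have e3 := denotes_or (denotes_not e2)
  (denotes_or (e1 u1 (Var 5) (Var 4) erefl erefl) (e1 u2 (Var 3) (Var 2) erefl erefl)).
rewrite /gen_eval -/(eReq _ _ _) in e3 *; rewrite e3 /=.
have -> : (u3 \in (if compat (T:=T) (witness_bound n) y u1 u2 then [set u1; u2] else setT)) =
   ~~ compat (T:=T) (witness_bound n) y u1 u2 || ((u3 == u1) || (u3 == u2)).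
  by case: ifP; rewrite !inE.
by case: (_ || _).
Qed.

Lemma enc_codom_enum_val (S : finType) (s0 : S) (f : {ffun 'I_#|S| -> nat}) (F : S -> nat) :
  (forall j, f j = F (enum_val j)) ->
  enc_nats (codom f) = catmap (fun a => nat_code (F a)) (enum S).
Proof.
move=> h; rewrite enc_natsE codomE catmap_map -(map_enum_val s0) catmap_map.
by apply: eq_catmap => j; rewrite h.
Qed.

Lemma gen_eval_for_const (S : Type) (s : seq S) env e g w :
  eval y env e = size s -> (forall u, gen_eval y (u :: env) g = w) ->
  gen_eval y env (For e g) = catmap (fun=> w) s.
Proof.
move=> es h; rewrite -[LHS]/(catmap _ (iota 0 (eval y env e))) (eq_catmap _ h).
by apply: catmap_const; rewrite size_iota.
Qed.

Lemma evalM env a b : eval y env (Mul a b) = eval y env a * eval y env b.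
Proof. by []. Qed.

Lemma enc_release : enc_nats (codom (release reduction.1)) =
  gen_eval y [:: n] (For (Mul (eNodes (Var 0)) (eNodes (Var 0))) gen_zero) ++
  gen_eval y [:: n] (For (eLate (Var 0)) (Bin (Mul (eGrid (Var 1)) (eGrid (Var 1))))).
Proof.
rewrite (@enc_codom_enum_val _ (inl (node0, node0) : J) _ (@job_release U (grid T)));
  last by move=> j; rewrite ffunE.
rewrite catmap_sum; congr (_ ++ _).
  rewrite (@eq_catmap _ _ (fun=> nat_code 0)) //; symmetry.
  apply: gen_eval_for_const => //; rewrite -cardT card_prod.
  by rewrite evalM eval_nodes.
rewrite (@eq_catmap _ _ (fun=> nat_code (grid T * grid T))) //; symmetry.
apply: gen_eval_for_const => [|u]; first by rewrite eval_late -cardT card_ord.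
rewrite -[LHS]/(nat_code (eval y [:: u; n] (Mul (eGrid (Var 1)) (eGrid (Var 1))))).
by rewrite evalM eval_grid.
Qed.

Lemma enc_req : enc_nats [seq (i \in req reduction.1 j : nat) | j <- enum 'I_(jobs reduction.1),
                                        i <- enum 'I_(resources reduction.1)] =
  gen_eval y [:: n] (gen_req) ++
  gen_eval y [:: n] (For (eLate (Var 0)) (For (eNodes (Var 1)) gen_one)).
Proof.
pose F (j : J) (u : U) := nat_code (u \in job_req (@compat M T (witness_bound n) y) j).
rewrite enc_natsE catmap_allpairs.
have -> : catmap (fun j => catmap (fun i => nat_code (i \in req reduction.1 j))
    (enum 'I_(resources reduction.1))) (enum 'I_(jobs reduction.1)) =
    catmap (fun j => catmap (F j) (enum U)) (enum {: J}).
  rewrite -(map_enum_val (inl (node0, node0) : J)) [RHS]catmap_map; apply: eq_catmap => j.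
  rewrite -(map_enum_val node0) [RHS]catmap_map; apply: eq_catmap => i.
  by rewrite /F /= ffunE inE.
rewrite catmap_sum; congr (_ ++ _).
  rewrite catmap_prod; symmetry; apply: gen_eval_for_node => u1.
  by apply: gen_eval_for_node => u2; apply: gen_eval_for_node => u3; apply: gen_eval_req.
symmetry; rewrite (@gen_eval_for_const _ (enum 'I_(late_jobs U (grid T))) _ _ _
   (catmap (fun=> nat_code 1) (enum U))).
- by apply: eq_catmap => l; apply: eq_catmap => u; rewrite /F /= inE.
- by rewrite eval_late size_enum_ord.
- by move=> u; apply: gen_eval_for_const => //; rewrite eval_nodes -cardE.
Qed.

Lemma reduction_enc : jrp_enc reduction = gen_eval y [:: n] gen_jrp.
Proof.
have encK : enc_nats (codom (K reduction.1)) = gen_eval y [:: n] (For (eNodes (Var 0)) gen_one).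
  rewrite (@enc_codom_enum_val _ node0 _ (fun=> 1)) => [|j]; last by rewrite ffunE.
  by symmetry; apply: gen_eval_for_const => //; rewrite eval_nodes -cardE.
have encP : enc_nats (codom (proc reduction.1)) =
    gen_eval y [:: n] (For (eJobs (Var 0)) gen_one).
  rewrite (@enc_codom_enum_val _ (inl (node0, node0) : J) _ (fun=> 1)) => [|j];
    last by rewrite ffunE.
  by symmetry; apply: gen_eval_for_const => //; rewrite eval_jobs -cardE.
rewrite /gen_jrp gen_eval_cat /jrp_enc enc_natsE /jrp_data.
have -> : forall a1 a2 a3 a4 r, catmap nat_code [:: a1, a2, a3, a4 & r] =
  nat_code a1 ++ nat_code a2 ++ nat_code a3 ++ nat_code a4 ++ enc_nats r by [].
have cat s1 s2 : enc_nats (s1 ++ s2) = enc_nats s1 ++ enc_nats s2 by apply: catmap_cat.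
rewrite !cat encK encP enc_release enc_req.
have -> : forall g1 g2 g3 g4 g5 g6 g7 g8 g9 g10,
  catmap (gen_eval y [:: n]) [:: g1; g2; g3; g4; g5; g6; g7; g8; g9; g10] =
  gen_eval y [:: n] g1 ++ gen_eval y [:: n] g2 ++ gen_eval y [:: n] g3 ++
  gen_eval y [:: n] g4 ++ gen_eval y [:: n] g5 ++ gen_eval y [:: n] g6 ++
  (gen_eval y [:: n] g7 ++ gen_eval y [:: n] g8) ++
  gen_eval y [:: n] g9 ++ gen_eval y [:: n] g10.
  by move=> *; rewrite /catmap /= cats0 -!catA.
have binE e m : eval y [:: n] e = m -> gen_eval y [:: n] (Bin e) = nat_code m by move=> <-.
by rewrite (binE _ _ (eval_threshold y [:: n] (Var 0))) (binE _ _ (eval_jobs y [:: n] (Var 0)))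
           (binE _ _ (eval_nodes y [:: n] (Var 0))).
Qed.

End Reduction.

(** * Correctness of the reduction *)

Lemma poly_bound_mono c d m n : m <= n -> poly_bound c d m <= poly_bound c d n.
Proof. by move=> le; rewrite leq_add2r leq_mul2l leq_expl ?orbT. Qed.

Lemma iter_halted M n (C : config M) : halted C -> iter n (@step M) C = C.
Proof. by move=> h; elim: n => //= n ->; rewrite /step h. Qed.

Lemma bits_prefix_head M (r : seq (sym M)) b s :
  bits_prefix r = b :: s -> nth None r 0 = Some (inl b).
Proof. by case: r => [|[[a|g]|] r] //= [-> _]. Qed.

(** Ensures that there are more nodes than [grid], as the clique construction demands. *)
Lemma card_tile_gt1 M : 1 < #|tile M|.
Proof.
pose f (b : bool) : tile M := (tm_start M, [ffun=> Some (inl b)], [ffun=> None]).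
have fi : injective f by move=> a b [] /ffunP/(_ ord0); rewrite !ffunE => -[].
by rewrite -card_bool -(card_codom fi) max_card.
Qed.

Lemma reduction_correct (R : archiRealDomainType) M c d cw dw (v : seq bool -> bool) :
  (forall z, let C := iter (poly_bound c d (size z)) (@step M) (init M z) in
     halted C /\ output C = [:: v z]) ->
  forall x, @dp_yes (jrp_sumC R) (reduction M c d cw dw x) <->
    exists2 w, size w <= poly_bound cw dw (size x) & v (pair_enc x w).
Proof.
move=> hM x; set T := horizon c d cw dw (size x).
have le : size (delimit x) + witness_bound cw dw (size x) <= T.
  by rewrite size_delimit /T /horizon /input_bound; lia.
have k0 : 0 < grid T by [].
have kU : grid T < #|node M T|.
  rewrite card_prod card_prod !card_ord -/(grid T) -{1}[grid T]muln1.
  by rewrite ltn_mul2l k0 card_tile_gt1.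
have acc w : size w <= poly_bound cw dw (size x) ->
    accepts M T (delimit x) w <-> v (pair_enc x w).
  move=> sw; have [ha ou] := hM (pair_enc x w).
  rewrite /accepts -/(pair_enc x w).
  set m := poly_bound c d _ in ha ou.
  (* The verifier has halted by time [T] for every admissible witness and keeps its answer until
     then. *)
  have mT : m <= T.
    apply: leq_trans (leq_addr _ _); apply: poly_bound_mono.
    by rewrite size_cat size_delimit /input_bound leq_add2l.
  rewrite -(subnK mT) iterD iter_halted //; move: ou; rewrite /output /=.
  by move=> /bits_prefix_head ->; split=> [[]|->].
have [h1 h2] := clique_jrp_correct
  (@compat M T (witness_bound cw dw (size x)) (delimit x)) (node0 M c d cw dw x) k0 kU R.
have [t1 t2] := tableau_correct M le.
split=> [/h1/t1[w sw /acc h]|[w sw /acc h]]; first by exists w => //; apply: h.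
by apply/h2/t2; exists w => //; apply: h.
Qed.

Theorem theorem3 (R : archiRealDomainType) :
  @NP_hard_on (jrp_sumC R)
    (fun IB : jrp * nat => unit_proc IB.1 /\ unit_resource_costs IB.1).
Proof.
move=> L [v [cw [dw [[M [c [d hM]]] hL]]]].
exists (reduction M c d cw dw); split.
- have [M' [c' [d' h]]] := gen_polytime (gen_jrp M c d cw dw).
  by exists M', c', d' => x; rewrite [dp_enc _]reduction_enc; apply: h.
- by move=> x; split=> [j|]; [rewrite ffunE | split=> // i; rewrite ffunE].
- by move=> x; apply: iff_trans (hL x) (iff_sym (reduction_correct R cw dw hM x)).
Qed.
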